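(* Fix $(\alpha,\beta,\theta)\in(0,1)^3$ and suppose $\alpha<\eta^{sig}_\theta(\beta)$. Consider the signal recovery problem in the ARW model with parameters $(\alpha,\beta,\theta)$. As $p\to\infty$: (i) $\mathrm{Hamm}_p(\hat S^{(sa)}_*,\alpha,\beta,\theta)\to0$ if $0<\beta<(1-\theta)/2$; (ii) $\mathrm{Hamm}_p(\hat S^{(sa)}_N,\alpha,\beta,\theta)\to0$ if $(1-\theta)/2<\beta<1$ and $N=\lceil p\epsilon_p\rceil$.
   Context: ARW model. For each $p$ let $n=n_p=p^\theta$ (treated as an integer), $\epsilon_p=p^{-\beta}$, $\tau_p=p^{-\alpha}$. The labels $\ell_1,\dots,\ell_n$ are i.i.d. uniform on $\{-1,1\}$; the coordinates of $\mu\in\mathbb R^p$ are i.i.d., equal to $\tau_p$ with probability $\epsilon_p$ and to $0$ with probability $1-\epsilon_p$; $Z$ is an $n\times p$ matrix with i.i.d. $N(0,1)$ entries; $\ell,\mu,Z$ are independent. One observes $X=\ell\mu'+Z=[x_1,\dots,x_p]\in\mathbb R^{n\times p}$. The support is $S(\mu)=\{1\le j\le p:\mu(j)\ne0\}$. Signal recovery error. $\mathrm{Hamm}_p(\hat S,\alpha,\beta,\theta)=(p\epsilon_p)^{-1}E(|\hat S\,\Delta\,S(\mu)|)$, where $\Delta$ is the symmetric difference and the expectation is over $(\mu,\ell,Z)$. Methods ($\mathrm{sgn}$ acts entrywise). Simple Aggregation: $\hat\ell^{(sa)}_*=\mathrm{sgn}(\sum_{j=1}^px_j)$, $y^{(sa)}_*=n^{-1/2}X'\hat\ell^{(sa)}_*$,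 and $\hat S^{(sa)}_*=\{1\le j\le p:|y^{(sa)}_{*,j}|\ge\sqrt{2\log p}\}$. Sparse Aggregation: $\hat S^{(sa)}_N$ is a maximizer of $N^{-1/2}\|\sum_{j\in S}x_j\|_1$ over $S\subset\{1,\dots,p\}$ with $|S|=N$. The curve: $\eta^{sig}_\theta(\beta)=\theta/2$ for $\beta\le1-\theta$ and $\eta^{sig}_\theta(\beta)=(1+\theta-\beta)/4$ for $\beta\ge1-\theta$. *)

(* Defs.v *)
From HB Require Import structures.
From mathcomp Require Import all_boot all_order all_algebra.
From mathcomp Require Import all_classical all_reals all_analysis.

Set Implicit Arguments.
Unset Strict Implicit.
Unset Printing Implicit Defensive.

Import Order.TTheory GRing.Theory Num.Theory.
Import numFieldNormedType.Exports.

Local Open Scope classical_set_scope.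
Local Open Scope ring_scope.

Definition mutually_independent (R : realType) (d : measure_display)
    (T : measurableType d) (P : probability T R) (I : finType)
    (Y : I -> {RV P >-> R}) : Prop :=
  forall (J : {set I}) (B : I -> set R), (forall k, measurable (B k)) ->
    P (\bigcap_(k in [set` J]) (Y k @^-1` B k)) =
    (\prod_(k in J) P (Y k @^-1` B k))%E.

Definition eps (R : realType) (beta : R) (p : nat) : R := p%:R `^ (- beta).
Definition tau (R : realType) (alpha : R) (p : nat) : R := p%:R `^ (- alpha).

Definition arw_family (A : Type) (n p : nat)
    (l : 'I_n -> A) (mu : 'I_p -> A) (Z : 'I_n -> 'I_p -> A)
    (k : 'I_n + 'I_p + 'I_n * 'I_p) : A :=
  match k with
  | inl (inl i) => l i
  | inl (inr j) => mu j
  | inr (i, j) => Z i j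
  end.

(* "p^theta, treated as an integer": any integer at distance less than 1 from
   p^theta is allowed, so that both roundings are covered and n = p^theta
   whenever p^theta is an integer.  Mutual independence of all scalar entries
   amounts to independence of l, mu, Z together with independence of the
   entries inside each of them. *)
Record arw_model (R : realType) (alpha beta theta : R) (p n : nat)
    (d : measure_display) (T : measurableType d) (P : probability T R)
    (l : 'I_n -> {RV P >-> R}) (mu : 'I_p -> {RV P >-> R})
    (Z : 'I_n -> 'I_p -> {RV P >-> R}) : Prop := ArwModel {
  arw_size : `|n%:R - p%:R `^ theta| < 1 ;
  arw_label_pos : forall i, P (l i @^-1` [set 1]) = (2^-1)%:E ;
  arw_label_neg : forall i, P (l i @^-1` [set -1]) = (2^-1)%:E ;
  arw_mean_tau : forall j, P (mu j @^-1` [set tau alpha p]) = (eps beta p)%:E ;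
  arw_mean_zero : forall j, P (mu j @^-1` [set 0]) = (1 - eps beta p)%:E ;
  arw_noise : forall i j (B : set R), measurable B ->
    distribution P (Z i j) B = normal_prob 0 1 B ;
  arw_indep : mutually_independent (arw_family l mu Z)
}.

Definition arw_data (R : realType) (T : Type) (n p : nat) (l : 'I_n -> T -> R)
    (mu : 'I_p -> T -> R) (Z : 'I_n -> 'I_p -> T -> R) (w : T) : 'M[R]_(n, p) :=
  (\col_i l i w) *m (\col_j mu j w)^T + \matrix_(i, j) Z i j w.

Definition signal_support (R : realType) (T : Type) (p : nat)
    (mu : 'I_p -> T -> R) (w : T) : {set 'I_p} :=
  [set j | mu j w != 0]%SET.

Definition symdiff (I : finType) (A B : {set I}) : {set I} :=
  ((A :\: B) :|: (B :\: A))%SET.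

(* Shat is the estimated support as a random set, i.e. already composed with
   the data. *)
Definition hamm (R : realType) (beta : R) (p : nat) (d : measure_display)
    (T : measurableType d) (P : probability T R) (mu : 'I_p -> T -> R)
    (Shat : T -> {set 'I_p}) : \bar R :=
  (((p%:R * eps beta p)^-1)%:E *
   'E_P[fun w => #|symdiff (Shat w) (signal_support mu w)|%:R])%E.

Definition sa_labels (R : realType) (n p : nat) (X : 'M[R]_(n, p)) : 'cV[R]_n :=
  map_mx Num.sg (\sum_(j < p) col j X).

Definition sa_scores (R : realType) (n p : nat) (X : 'M[R]_(n, p)) : 'cV[R]_p :=
  (Num.sqrt n%:R)^-1 *: (X^T *m sa_labels X).

Definition sa_support (R : realType) (n p : nat) (X : 'M[R]_(n, p)) :
    {set 'I_p} :=
  [set j | Num.sqrt (2 * ln p%:R) <= `|sa_scores X j 0|]%SET.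

Definition norm1 (R : realType) (n : nat) (v : 'cV[R]_n) : R :=
  \sum_(i < n) `|v i 0|.

Definition sparse_sa_objective (R : realType) (n p N : nat)
    (X : 'M[R]_(n, p)) (S : {set 'I_p}) : R :=
  (Num.sqrt N%:R)^-1 * norm1 (\sum_(j in S) col j X).

Definition is_sparse_sa_support (R : realType) (n p N : nat)
    (X : 'M[R]_(n, p)) (S : {set 'I_p}) : Prop :=
  #|S| = N /\ forall S' : {set 'I_p}, #|S'| = N ->
    sparse_sa_objective N X S' <= sparse_sa_objective N X S.

Definition sparse_size (R : realType) (beta : R) (p : nat) : nat :=
  `|Num.ceil (p%:R * eps beta p)|%N.

Definition eta_sig (R : realType) (theta beta : R) : R :=
  if beta <= 1 - theta then theta / 2 else (1 + theta - beta) / 4.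

(* Main.v *)
Require Import Defs.
From HB Require Import structures.
From mathcomp Require Import all_boot all_order all_algebra.
From mathcomp Require Import all_classical all_reals all_analysis.
From mathcomp Require Import measurable_realfun ring lra zify.

(** Part (i).  The row sums of [X] are [l_i * sum_j mu_j] plus Gaussian noise of
    variance [p]; since [alpha + beta < 1/2] the signal is polynomially larger
    than the noise, so the labels are all recovered up to an event of
    exponentially small probability.  Once the labels are known the scores are
    [sqrt n * mu_j + N(0, 1)], and [sqrt n * tau] is polynomially larger than
    the threshold [sqrt (2 log p)].

    Part (ii).  Given [mu], the objective at [S] is distributed as
    [sum_i |u_S + g_i|] with [g_i] i.i.d. standard normal and
    [u_S = tau |S :&: supp mu| / sqrt N].  Its mean is [n h(u_S)], where
    [h u = E |u + g|], and it is subgaussian with variance proxy of order [n],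
    so a union bound over the at most [p ^ N] sets [S] gives a uniform deviation
    of order [sqrt (n N log p)].  As [h u = E max(u, |g|)] for [u >= 0], a
    deficit [d v] in [u_S] from [u = v := tau sqrt N] costs at least of order
    [n d v min(v, 1)] in the mean; the two conditions [alpha < theta / 2] and
    [4 alpha < 1 + theta - beta] say that this exceeds the deviation, so that
    the maximizer captures almost all of the support. *)

Set Implicit Arguments.
Unset Strict Implicit.
Unset Printing Implicit Defensive.

Import Order.TTheory GRing.Theory Num.Theory.
Import numFieldNormedType.Exports.

Local Open Scope classical_set_scope.
Local Open Scope ring_scope.

(** * Independent families *)

(** The mean [h] is flat at 0: its slope at [u] is of order [min(u, 1)], which is where [min(v, 1)]
    comes from. With [t] of order [sqrt (N log p / n)] and [v = tau sqrt N], the deviation must be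
    small against [v] when [v] is large and against [v ^ 2] when [v] is small. Squared, these
    requirements read [n tau ^ 2 >> log p] and [n tau ^ 4 N >> log p], that is [2 alpha < theta] and
    [4 alpha < 1 + theta - beta]. The unknown labels disappear from the objective because
    [|l m + z| = |m + l z|] for a sign [l], and [l z] is again standard normal and independent of
    [mu]. Conditioning on [mu] is replaced by the law of total probability over the finitely many
    events [supp = M], on each of which the signal level is a constant. This needs independence of
    functions of groups of entries, while the model only states independence of the entries
    themselves. Exceptional events enter through a single nonnegative function that is at least 1 on
    all of them, so that every Hamming bound is a pointwise inequality integrated once. *)

Section block_independence.
Context (R : realType) (d : measure_display) (T : measurableType d).
Variable P : probability T R.

(** Subfamilies are covered by the full intersection, since any [B k] may be [setT]. *)
Definition indep_family (I : finType) (W : I -> T -> R) : Prop :=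
  (forall k, measurable_fun setT (W k)) /\
  forall B : I -> set R, (forall k, measurable (B k)) ->
    P (\bigcap_k (W k @^-1` B k)) = (\prod_k P (W k @^-1` B k))%E.

(** A pi-system generating the sigma-algebra of the variables [Y k] with [f k = a]. Functions of
    that group of variables are expressed as functions measurable for [<<s block Y f a >>]. *)
Definition block (I A : finType) (Y : I -> T -> R) (f : I -> A) (a : A) :
    set (set T) :=
  [set C | exists2 B : I -> set R, (forall k, measurable (B k)) &
    C = \bigcap_(k in [set k | f k = a]) (Y k @^-1` B k)].

Variables (I A : finType) (Y : I -> T -> R) (f : I -> A).
Hypothesis indepY : indep_family Y.

Let mpre k (B : set R) : measurable B -> measurable (Y k @^-1` B).
Proof. by move=> mB; rewrite -[X in measurable X]setTI; exact: (indepY.1 k). Qed.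

Let mblock a : block Y f a `<=` measurable.
Proof.
move=> _ [B mB ->]; apply: fin_bigcap_measurable => // k _; exact: mpre.
Qed.

Let sblock a : <<s block Y f a >> `<=` measurable.
Proof. apply: smallest_sub; [exact: sigma_algebra_measurable | exact: mblock]. Qed.

Let blockI a : setI_closed (block Y f a).
Proof.
move=> _ _ [B mB ->] [C mC ->]; exists (fun k => B k `&` C k).
  by move=> k; exact: measurableI.
by rewrite -bigcapI.
Qed.

Let blockT a : block Y f a setT.
Proof. by exists (fun=> setT) => //; apply/seteqP; split. Qed.

Let blocks_indep (C : A -> set T) : (forall a, block Y f a (C a)) ->
  P (\bigcap_a C a) = (\prod_a P (C a))%E.
Proof.
move=> bC.
have /choice[B B_] : forall a, exists B : I -> set R,
    (forall k, measurable (B k)) /\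
    C a = \bigcap_(k in [set k | f k = a]) (Y k @^-1` B k).
  by move=> a; have [B mB CB] := bC a; exists B.
have prodC a : P (C a) = (\prod_(k | f k == a) P (Y k @^-1` B a k))%E.
  rewrite (B_ a).2 (_ : bigcap _ _ =
      \bigcap_k (Y k @^-1` (if f k == a then B a k else setT))).
    rewrite indepY.2; last by move=> k; case: ifP => // _; exact: (B_ a).1.
    rewrite [RHS]big_mkcond/=; apply: eq_bigr => k _; case: ifP => // _.
    by rewrite preimage_setT probability_setT.
  apply/seteqP; split => w Bw k.
    by move=> _ /=; case: eqP => // fk; exact: Bw.
  by move=> /= fk; have := Bw k Logic.I; rewrite /= fk eqxx.
rewrite (_ : bigcap _ _ = \bigcap_k (Y k @^-1` B (f k) k)).
  rewrite indepY.2; last by move=> k; exact: (B_ _).1.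
  rewrite (partition_big f xpredT)//=; apply: eq_bigr => a _.
  by rewrite prodC; apply: eq_bigr => k /eqP ->.
apply/seteqP; split => w Cw k _.
  by have := Cw (f k) Logic.I; rewrite (B_ _).2; exact.
by rewrite (B_ k).2 => i /= <-; exact: Cw.
Qed.

(** Blocks are upgraded from the pi-system to its sigma-algebra one at a time, by induction on the
    list [s] of upgraded blocks. *)
Lemma sigma_blocks_indep (C : A -> set T) :
  (forall a, <<s block Y f a >> (C a)) ->
  P (\bigcap_a C a) = (\prod_a P (C a))%E.
Proof.
suff H (s : seq A) : forall C, (forall a, a \in s -> <<s block Y f a >> (C a)) ->
    (forall a, a \notin s -> block Y f a (C a)) ->
    P (\bigcap_a C a) = (\prod_a P (C a))%E.
  move=> sC; apply: (H (enum A)) => a; first by [].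
  by rewrite mem_enum.
elim: s => [|a s IH] {}C sC bC; first by apply: blocks_indep => a; exact: bC.
have mC b : measurable (C b).
  have [bs|bs] := boolP (b \in a :: s); first by apply: (@sblock b); exact: sC.
  by apply: (@mblock b); exact: bC.
pose rest := \bigcap_(b in [set b | b != a]) C b.
have mrest : measurable rest by apply: fin_bigcap_measurable => [|b _] //; exact: finite_finset.
pose c := (\prod_(b | b != a) P (C b))%E.
have c0 : (0 <= c)%E by apply: prode_ge0 => b _; exact: measure_ge0.
have cfin : c \is a fin_num by apply: prode_fin_num => b _; rewrite fin_num_measure.
(* With the other blocks fixed, [P (X :&: rest)] and [c P X] are finite measures in [X]. By
   induction they agree on the pi-system of block [a], hence on what it generates. *)
pose m1 : {measure set T -> \bar R} := mrestr P mrest.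
pose m2 : {measure set T -> \bar R} := mscale (NngNum (fine_ge0 c0)) P.
have m2E X : m2 X = (P X * c)%E.
  rewrite /m2 /mscale/= muleC; congr (_ * _)%E.
  by rewrite fineK.
have m1E X : m1 X = P (X `&` rest) by [].
have split_a X : \bigcap_b (if b == a then X else C b) = X `&` rest.
  apply/seteqP; split => w /=.
    move=> Xw; split; first by have := Xw a Logic.I; rewrite eqxx.
    by move=> b /= /negbTE ba; have := Xw b Logic.I; rewrite ba.
  by move=> [Xw rw] b _; case: eqP => // /eqP ba; exact: rw.
have prod_a X : (\prod_b P (if b == a then X else C b) = P X * c)%E.
  rewrite (bigD1 a)//= eqxx; congr (_ * _)%E.
  by apply: eq_bigr => b /negbTE ->.
have m12 X : <<s block Y f a >> X -> m1 X = m2 X.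
  apply: (@g_sigma_algebra_measure_unique _ R _ _ (@mblock a) (fun=> setT)).
  - by move=> _; exact: blockT.
  - by rewrite bigcup_const//; exists 0%N.
  - exact: blockI.
  - move=> Z bZ; rewrite m2E m1E -prod_a -split_a.
    apply: IH => b.
      case: eqP => [->|/eqP ba] bs; first exact: sub_sigma_algebra.
      by apply: sC; rewrite in_cons bs orbT.
    case: eqP => [-> //|/eqP ba] bs.
    by apply: bC; rewrite in_cons negb_or ba.
  - move=> _; rewrite /m1 /mrestr/=; apply: le_lt_trans (probability_le1 _ _) _.
      by rewrite setTI.
    exact: ltry.
have := m12 (C a); rewrite m2E m1E -prod_a -split_a.
have CE b : (if b == a then C a else C b) = C b by case: eqP => // ->.
under eq_bigcapr do rewrite CE.
under eq_bigr do rewrite CE.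
by apply; apply: sC; rewrite mem_head.
Qed.

Lemma block_measurable_coord a k : f k = a -> measurable_fun
  (setT : set (g_sigma_algebraType (block Y f a)))
  (Y k : g_sigma_algebraType (block Y f a) -> R).
Proof.
move=> fk _ B mB; rewrite setTI; apply: sub_sigma_algebra.
exists (fun i => if i == k then B else setT); first by move=> i; case: ifP.
apply/seteqP; split => [w Bw i _ /=|w Bw]; first by case: eqP => // ->.
by have := Bw k fk; rewrite /= eqxx.
Qed.

(** Grouping principle: variables computed from disjoint groups of independent coordinates are
    independent. Later independence claims come from a suitable choice of [f]. *)
Lemma indep_family_blocks (W : A -> T -> R) :
  (forall a, measurable_fun (setT : set (g_sigma_algebraType (block Y f a)))
     (W a : g_sigma_algebraType (block Y f a) -> R)) ->
  indep_family W.
Proof.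
move=> mW; split.
  move=> a _ B mB; rewrite setTI; apply: (@sblock a).
  by have := mW a measurableT B mB; rewrite setTI.
move=> B mB; apply: sigma_blocks_indep => a.
by have := mW a measurableT _ (mB a); rewrite setTI.
Qed.

End block_independence.

(** * Independent pairs and expectations of products *)

Section independent_pairs.
Context (R : realType) (d : measure_display) (T : measurableType d).
Variable P : probability T R.

(* [R] and [measurableTypeR R] have the same measurable sets but different
   displays; laws live on the latter, as [lebesgue_measure] does. *)
Definition to_mfun (X : T -> R) (mX : measurable_fun setT X) :
    {mfun T >-> measurableTypeR R} :=
  HB.pack_for {mfun T >-> measurableTypeR R} (X : T -> measurableTypeR R)
    (isMeasurableFun.Build _ _ T (measurableTypeR R) (X : T -> measurableTypeR R) mX).

Definition indep_pair (X Y : T -> R) : Prop :=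
  forall A B : set R, measurable A -> measurable B ->
    P (X @^-1` A `&` Y @^-1` B) = (P (X @^-1` A) * P (Y @^-1` B))%E.

(** Independence says that the joint law agrees with the product law on rectangles; uniqueness of
    the product measure and Tonelli do the rest. *)
Lemma integral_indep_pair (X Y : {mfun T >-> measurableTypeR R}) (F : R * R -> \bar R) :
  indep_pair X Y -> measurable_fun [set: R * R] F -> (forall z, 0 <= F z)%E ->
  (\int[P]_w F (X w, Y w) =
   \int[distribution P X]_x \int[distribution P Y]_y F (x, y))%E.
Proof.
move=> indXY mF F0.
have mXY : measurable_fun setT (fun w => (X w, Y w) : measurableTypeR R * measurableTypeR R).
  by apply/measurable_fun_pairP; split; exact: measurable_funP.
pose XY : {mfun T >-> (measurableTypeR R * measurableTypeR R)%type} :=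
  HB.pack (fun w => (X w, Y w))
  (isMeasurableFun.Build _ _ _ _ _ mXY).
have -> : (\int[P]_w F (X w, Y w) = \int[distribution P XY]_z F z)%E.
  by rewrite ge0_integral_distribution.
rewrite -fubini_tonelli1//.
apply: eq_measure_integral => C mC _.
apply/esym; apply: (@product_measure_unique _ _ _ _ _ (distribution P X)
  (distribution P Y) (distribution P XY)) => //.
Qed.

Lemma expectation_indepM (X Y : {mfun T >-> measurableTypeR R}) : indep_pair X Y ->
  (forall w, 0 <= X w) -> (forall w, 0 <= Y w) ->
  (\int[P]_w (X w * Y w)%:E = (\int[P]_w (X w)%:E) * (\int[P]_w (Y w)%:E))%E.
Proof.
move=> indXY X0 Y0.
(* Tonelli asks for nonnegativity on the whole plane, whereas [X] and [Y] are nonnegative only as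
   functions on [T]; positive parts repair this without changing the integrand. *)
pose F (z : measurableTypeR R * measurableTypeR R) : \bar R :=
  (Num.max 0 z.1 * Num.max 0 z.2)%:E.
have mF : measurable_fun [set: R * R] F.
  apply/measurable_EFinP; apply: measurable_funM; apply: measurable_maxr => //.
have F0 z : (0 <= F z)%E by rewrite lee_fin mulr_ge0// le_max lexx.
have mpos : measurable_fun setT (fun x : R => (Num.max 0 x)%:E).
  by apply/measurable_EFinP; apply: measurable_maxr.
have pos_ge0 (x : R) : (0 <= (Num.max 0 x)%:E)%E by rewrite lee_fin le_max lexx.
transitivity (\int[P]_w F (X w, Y w))%E.
  by apply: eq_integral => w _; rewrite /F/= !max_r.
rewrite integral_indep_pair//.
under eq_integral => x _ do rewrite /F/= (eq_integral _ _ (fun y _ => EFinM _ _)) ge0_integralZl//.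
rewrite ge0_integralZr//; last by apply: integral_ge0 => y _.
rewrite !ge0_integral_distribution//.
by congr (_ * _)%E; apply: eq_integral => w _ /=; rewrite max_r.
Qed.

Lemma indep_family_pair (I : finType) (W : I -> T -> R) (a b : I) :
  indep_family P W -> a != b -> indep_pair (W a) (W b).
Proof.
move=> [mW indW] ab A B mA mB.
pose C k := if k == a then A else if k == b then B else setT.
have mC k : measurable (C k) by rewrite /C; case: ifP => // _; case: ifP.
have -> : W a @^-1` A `&` W b @^-1` B = \bigcap_k (W k @^-1` C k).
  apply/seteqP; split => [w [Aw Bw] k _|w Cw].
    by rewrite /C/=; case: eqP => [->//|_]; case: eqP => [->|].
  have := Cw a Logic.I; have := Cw b Logic.I.
  by rewrite /C/= !eqxx eq_sym (negbTE ab).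
rewrite indW// (bigD1 a)//= (bigD1 b)/=; last by rewrite eq_sym.
rewrite [X in (_ * (_ * X))%E]big1 ?mule1.
  by rewrite /C !eqxx eq_sym (negbTE ab).
move=> k /andP[/negbTE ka /negbTE kb].
by rewrite /C ka kb preimage_setT probability_setT.
Qed.

Lemma expectation_indep_prod (I : finType) (W : I -> T -> R) (g : I -> R -> R) :
  indep_family P W -> (forall k, measurable_fun setT (g k)) ->
  (forall k x, 0 <= g k x) ->
  (\int[P]_w (\prod_k g k (W k w))%:E = \prod_k \int[P]_w (g k (W k w))%:E)%E.
Proof.
move=> indW mg g0.
have mgW k : measurable_fun setT (g k \o W k).
  exact: measurableT_comp (mg k) (indW.1 k).
elim: (index_enum I) (index_enum_uniq I) => [_|k s IH /= /andP[ks us]].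
  under eq_integral do rewrite big_nil.
  by rewrite integral_cst// big_nil mul1e; exact: probability_setT.
rewrite big_cons -IH//.
(* The head factor and the remaining product depend on the two groups cut out by [j == k], hence are
   independent. *)
pose V (b : bool) w := if b then g k (W k w) else \prod_(j <- s) g j (W j w).
have indV : indep_family P V.
  apply: (indep_family_blocks (f := fun j => j == k) indW) => -[].
    by apply: measurableT_comp (mg k) _; apply: block_measurable_coord; rewrite eqxx.
  apply: measurable_prod => j js.
  apply: measurableT_comp (mg j) _; apply: block_measurable_coord.
  by apply/negbTE; apply: contraNneq ks => <-.
pose V1 := to_mfun (indV.1 true).
pose V0 := to_mfun (indV.1 false).
under eq_integral do rewrite big_cons.
apply: (@expectation_indepM V1 V0) => [|w|w].
- by apply: (indep_family_pair indV).
- exact: g0.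
- by rewrite /V0/= /V; apply: prodr_ge0.
Qed.

End independent_pairs.

(** * The standard normal distribution *)

Section density.
Context (R : realType) (d : measure_display) (T : measurableType d).
Variables (mu nu : {measure set T -> \bar R}) (p : T -> R).
Hypothesis mp : measurable_fun setT p.
Hypothesis p0 : forall x, 0 <= p x.
Hypothesis nuE : forall A, measurable A -> nu A = (\int[mu]_(x in A) (p x)%:E)%E.
Local Open Scope ereal_scope.
Import HBNNSimple.

Let integral_density_nnsfun (h : {nnsfun T >-> R}) :
  \int[nu]_x (h x)%:E = \int[mu]_x ((h x)%:E * (p x)%:E).
Proof.
under eq_integral do rewrite fimfunE -fsumEFin//.
rewrite ge0_integral_fsum//; last 2 first.
  by move=> r; exact/measurable_EFinP/measurableT_comp.
  by move=> r x _; rewrite nnfun_muleindic_ge0.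
have hE x : (h x)%:E * (p x)%:E =
    \sum_(r \in range h) (r%:E * (\1_(h @^-1` [set r]) x * p x)%:E).
  rewrite fimfunE -fsumEFin// ge0_mule_fsuml; last by move=> r; rewrite nnfun_muleindic_ge0.
  by apply: eq_fsbigr => r _; rewrite -!EFinM mulrA.
under [RHS]eq_integral do rewrite hE.
rewrite ge0_integral_fsum//; last 2 first.
  move=> r; apply/measurable_EFinP; do 2 (apply: measurable_funM => //).
  by move=> r x _; rewrite -EFinM lee_fin mulrA mulr_ge0//;
    have := nnfun_muleindic_ge0 h r x; rewrite lee_fin.
apply: eq_fsbigr => r /[!inE] -[x _ rx].
have r0 : (0 <= r)%R by rewrite -rx.
rewrite integralZl_indic_nnsfun// ge0_integralZl//; last 2 first.
- by apply/measurable_EFinP; apply: measurable_funM.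
- by move=> y _; rewrite lee_fin mulr_ge0.
congr (_ * _); rewrite integral_indic// setIT nuE//.
rewrite [LHS]integral_mkcond; apply: eq_integral => y _.
by rewrite patchE indicE; case: ifP => _; rewrite ?mul1r ?mul0r.
Qed.

Lemma ge0_integral_density (f : T -> \bar R) :
  measurable_fun setT f -> (forall x, 0 <= f x) ->
  \int[nu]_x f x = \int[mu]_x (f x * (p x)%:E).
Proof.
move=> mf f0; pose f_ := nnsfun_approx measurableT mf.
have f_cvg x : (f_ n x)%:E @[n --> \oo] --> f x.
  by apply: cvg_nnsfun_approx.
have f_nd x : {homo (fun n => (f_ n x)%:E) : m n / (m <= n)%N >-> m <= n}.
  by move=> m n mn; rewrite lee_fin; exact/lefP/nd_nnsfun_approx.
transitivity (limn (fun n => \int[nu]_x (f_ n x)%:E)).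
  rewrite -monotone_convergence//.
  - by apply: eq_integral => x _; apply/esym/cvg_lim.
  - by move=> n; exact/measurable_EFinP.
  - by move=> n x _; rewrite lee_fin.
rewrite (_ : (fun n => _) = (fun n => \int[mu]_x ((f_ n x)%:E * (p x)%:E))); last first.
  by apply/funext => n; exact: integral_density_nnsfun.
rewrite -monotone_convergence//.
- apply: eq_integral => x _; apply/cvg_lim => //.
  by apply: cvgeZr.
- by move=> n; apply/measurable_EFinP; apply: measurable_funM.
- by move=> n x _; rewrite lee_fin mulr_ge0.
- by move=> x _ m n mn; rewrite lee_wpmul2r ?lee_fin//; have := f_nd x _ _ mn; rewrite lee_fin.
Qed.

End density.

(** * Affine changes of variable for Lebesgue measure *)

Section lebesgue_affine.
Context (R : realType).
Local Notation leb := (@lebesgue_measure R).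

(** Pushing Lebesgue measure forward by [a + s y] and scaling by [s] gives every half-open interval
    its length, which characterises Lebesgue measure. *)
Let lebesgue_measure_affine (a s : R) (A : set R) : 0 < s -> measurable A ->
  leb A = (s%:E * leb ((fun y => a + s * y)%R @^-1` A))%E.
Proof.
move=> s0 mA.
have maff0 : measurable_fun setT (fun y : R => a + s * y).
  by apply: measurable_funD => //; apply: measurable_funM.
have maff : measurable_fun [set: measurableTypeR R]
  ((fun y : R => a + s * y) : measurableTypeR R -> measurableTypeR R) by exact: maff0.
pose aff : {mfun measurableTypeR R >-> measurableTypeR R} := HB.pack (fun y : R => a + s * y)
  (isMeasurableFun.Build _ _ _ _ _ maff).
pose m : {measure set (measurableTypeR R) -> \bar R} :=
  mscale (NngNum (ltW s0)) (pushforward leb aff).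
rewrite (@lebesgue_measure_unique _ (m maff))//.
move=> _ [[x y] _ <-].
rewrite [RHS](_ : _ = s%:E * leb ((fun z => a + s * z)%R @^-1` `]x, y]%classic))%E; last by [].
rewrite (_ : _ @^-1` _ = `](x - a) / s, (y - a) / s]%classic); last first.
  apply/seteqP; split => z /=; rewrite !in_itv/= ltr_pdivrMr// ler_pdivlMr//;
    by rewrite (mulrC z) ltrBlDl lerBrDl.
rewrite !lebesgue_measure_itv/= !lte_fin ltr_pM2r ?invr_gt0// ltrD2r.
case: ifP => _; last by rewrite mule0.
by rewrite -!EFinB -EFinM -mulrBl opprB addrA subrK mulrCA divff ?mulr1// gt_eqF.
Qed.

Lemma ge0_integral_lebesgue_affine (a s : R) (f : R -> \bar R) : 0 < s ->
  measurable_fun setT f -> (forall x, 0 <= f x)%E ->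
  (\int[leb]_x f x = s%:E * \int[leb]_y f (a + s * y)%R)%E.
Proof.
move=> s0 mf f0.
have maff0 : measurable_fun setT (fun y : R => a + s * y).
  by apply: measurable_funD => //; apply: measurable_funM.
have maff : measurable_fun [set: measurableTypeR R]
  ((fun y : R => a + s * y) : measurableTypeR R -> measurableTypeR R) by exact: maff0.
pose aff : {mfun measurableTypeR R >-> measurableTypeR R} := HB.pack (fun y : R => a + s * y)
  (isMeasurableFun.Build _ _ _ _ _ maff).
pose m : {measure set (measurableTypeR R) -> \bar R} :=
  mscale (NngNum (ltW s0)) (pushforward leb aff).
transitivity (\int[m maff]_x f x)%E.
  by apply: eq_measure_integral => A mA _; exact: lebesgue_measure_affine.
by rewrite /m ge0_integral_mscale//= ge0_integral_pushforward.
Qed.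

Lemma ge0_integral_lebesgueN (f : R -> \bar R) :
  measurable_fun setT f -> (forall x, 0 <= f x)%E ->
  (\int[leb]_x f x = \int[leb]_x f (- x)%R)%E.
Proof.
move=> mf f0.
transitivity (\int[pushforward leb (-%R : R -> measurableTypeR R)]_x f x)%E.
  by apply: eq_measure_integral => A mA _; apply: esym; exact: lebesgue_measureN.
by rewrite ge0_integral_pushforward.
Qed.

End lebesgue_affine.

Section standard_normal.
Context (R : realType).
Local Notation leb := (@lebesgue_measure R).
Local Notation gam := (normal_prob (0 : R) 1).

Lemma normal_pdfE1 (m s x : R) : s != 0 ->
  normal_pdf m s x = normal_peak s * expR (- (x - m) ^+ 2 / (s ^+ 2 *+ 2)).
Proof. by move=> s0; rewrite normal_pdfE. Qed.

Lemma ge0_integral_normal_prob (m s : R) (f : R -> \bar R) :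
  measurable_fun setT f -> (forall x, 0 <= f x)%E ->
  (\int[normal_prob m s]_x f x = \int[leb]_x (f x * (normal_pdf m s x)%:E))%E.
Proof.
move=> mf f0; apply: (@ge0_integral_density R _ (measurableTypeR R) leb
  (normal_prob m s) (normal_pdf m s)) => //; first exact: measurable_normal_pdf.
by move=> x; exact: normal_pdf_ge0.
Qed.

Lemma mgf_standard_normal (t : R) :
  (\int[gam]_x (expR (t * x))%:E = (expR (t ^+ 2 / 2))%:E)%E.
Proof.
rewrite ge0_integral_normal_prob//; last first.
  by apply/measurable_EFinP; apply: measurableT_comp => //; exact: measurable_funM.
(* Complete the square: [t x - x ^ 2 / 2 = t ^ 2 / 2 - (x - t) ^ 2 / 2]. *)
transitivity (\int[leb]_x ((expR (t ^+ 2 / 2))%:E * (normal_pdf t 1 x)%:E))%E.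
  apply: eq_integral => x _; rewrite -!EFinM !normal_pdfE1//; congr EFin.
  rewrite mulrCA [RHS]mulrCA -!expRD; congr (_ * expR _); by field.
rewrite ge0_integralZl//.
- by rewrite integral_normal_pdf mule1.
- by apply/measurable_EFinP; exact: measurable_normal_pdf.
- by move=> x _; rewrite lee_fin normal_pdf_ge0.
Qed.

Lemma ge0_integral_standard_normalN (f : R -> \bar R) :
  measurable_fun setT f -> (forall x, 0 <= f x)%E ->
  (\int[gam]_x f (- x)%R = \int[gam]_x f x)%E.
Proof.
move=> mf f0.
rewrite !ge0_integral_normal_prob//; last exact: measurableT_comp.
rewrite [RHS](@ge0_integral_lebesgueN _ (fun x => f x * (normal_pdf 0 1 x)%:E)%E).
- apply: eq_integral => x _; congr (_ * _%:E)%E.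
  by rewrite !normal_pdfE1// !subr0 sqrrN.
- apply: emeasurable_funM => //; apply/measurable_EFinP; exact: measurable_normal_pdf.
- by move=> x; rewrite mule_ge0// lee_fin normal_pdf_ge0.
Qed.

Lemma normal_peakM (s t : R) : 0 <= s -> normal_peak (s * t) = normal_peak t / s.
Proof.
move=> s0; rewrite /normal_peak exprMn -mulrA -mulrnAr sqrtrM ?sqr_ge0//.
by rewrite sqrtr_sqr ger0_norm// invfM mulrC.
Qed.

(* Completing the square: [x ^ 2 + ((z - c x) / s) ^ 2 = ((x - c z) / s) ^ 2 + z ^ 2]. *)
Lemma integral_standard_normal_rot (c s : R) (f : R -> \bar R) :
  0 < s -> c ^+ 2 + s ^+ 2 = 1 ->
  measurable_fun setT f -> (forall x, 0 <= f x)%E ->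
  (\int[gam]_x \int[gam]_y f (c * x + s * y)%R = \int[gam]_z f z)%E.
Proof.
move=> s0 cs mf f0.
have sN0 : s != 0 by rewrite gt_eqF.
(* [g (x, z)] is [f z] times the joint density of [x] and [z = c x + s y]; the factor [s^-1] is the
   Jacobian of [y |-> z]. *)
pose g (u : R * R) : \bar R :=
  (f u.2 * (normal_pdf 0 1 u.1 * (s^-1 * normal_pdf 0 1 (s^-1 * (u.2 - c * u.1))))%:E)%E.
have mg : measurable_fun [set: R * R] g.
  apply: emeasurable_funM; first exact: measurableT_comp.
  apply/measurable_EFinP; apply: measurable_funM.
    exact: measurableT_comp (measurable_normal_pdf _ _) _.
  apply: measurable_funM => //.
  apply: measurableT_comp (measurable_normal_pdf _ _) _.
  apply: measurable_funM => //; apply: measurable_funB => //.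
  exact: measurable_funM.
have g0 u : (0 <= g u)%E.
  by rewrite mule_ge0// lee_fin !mulr_ge0 ?normal_pdf_ge0 ?invr_ge0// ltW.
have inner x : (\int[gam]_y f (c * x + s * y)%R * (normal_pdf 0 1 x)%:E =
    \int[leb]_z g (x, z))%E.
  rewrite ge0_integral_normal_prob//; last first.
    apply: measurableT_comp => //; apply: measurable_funD => //; exact: measurable_funM.
  rewrite (@ge0_integral_lebesgue_affine _ (c * x) s (fun z => g (x, z)))//; last first.
    exact: measurableT_comp mg _.
  rewrite -ge0_integralZl//; last 2 first.
  - apply: (measurableT_comp (f := fun z => g (x, z))); first exact: measurableT_comp mg _.
    by apply: measurable_funD => //; exact: measurable_funM.
  - by rewrite lee_fin ltW.
  rewrite -ge0_integralZr//; last 3 first.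
  - apply: emeasurable_funM.
      by apply: measurableT_comp => //; apply: measurable_funD => //; exact: measurable_funM.
    by apply/measurable_EFinP; exact: measurable_normal_pdf.
  - by move=> y _; rewrite mule_ge0// lee_fin normal_pdf_ge0.
  - by rewrite lee_fin normal_pdf_ge0.
  apply: eq_integral => y _; rewrite /g/= muleCA -muleA; congr (_ * _)%E.
  rewrite -!EFinM; congr EFin.
  rewrite [c * x + s * y - _]addrC addKr mulKf//.
  by rewrite [RHS]mulrCA [s * _]mulrA divff// mul1r mulrC.
rewrite ge0_integral_normal_prob//; last 2 first.
  apply: (@measurable_fun_fubini_tonelli_F _ _ (measurableTypeR R) (measurableTypeR R) R
    gam (fun u => f (c * u.1 + s * u.2))) => //.
  by apply: measurableT_comp => //; apply: measurable_funD; apply: measurable_funM.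
  by move=> x; apply: integral_ge0.
under eq_integral do rewrite inner.
rewrite (@fubini_tonelli _ _ _ _ R leb leb g)// ge0_integral_normal_prob//.
apply: eq_integral => z _.
(* After exchanging the integrals, the dependence on [x] for fixed [z] is a normal density of mean
   [c z] and deviation [s], which integrates to 1. *)
transitivity (\int[leb]_x ((f z * (normal_pdf 0 1 z)%:E) * (normal_pdf (c * z) s x)%:E))%E.
  apply: eq_integral => x _; rewrite /g/= -muleA; congr (_ * _)%E.
  rewrite -EFinM !normal_pdfE1//; congr EFin.
  have -> : normal_peak s = normal_peak 1 / s by rewrite -normal_peakM ?mulr1// ltW.
  rewrite [LHS](_ : _ = normal_peak 1 * (normal_peak 1 / s) *
    (expR (- (x - 0) ^+ 2 / (1 ^+ 2 *+ 2)) *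
     expR (- (s^-1 * (z - c * x) - 0) ^+ 2 / (1 ^+ 2 *+ 2)))); last by ring.
  rewrite [RHS](_ : _ = normal_peak 1 * (normal_peak 1 / s) *
    (expR (- (z - 0) ^+ 2 / (1 ^+ 2 *+ 2)) *
     expR (- (x - c * z) ^+ 2 / (s ^+ 2 *+ 2)))); last by ring.
  rewrite -!expRD; congr (_ * expR _).
  have s2 : s ^+ 2 = 1 - c ^+ 2 by rewrite -cs; ring.
  have -> : (s^-1 * (z - c * x) - 0) ^+ 2 = (z - c * x) ^+ 2 / (1 - c ^+ 2).
    by rewrite subr0 exprMn exprVn mulrC s2.
  have c1 : 1 - c ^+ 2 != 0 by rewrite -s2 sqrf_eq0.
  rewrite s2; by field.
rewrite ge0_integralZl//.
- by rewrite integral_normal_pdf mule1.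
- by apply/measurable_EFinP; exact: measurable_normal_pdf.
- by move=> x _; rewrite lee_fin normal_pdf_ge0.
- by rewrite mule_ge0// lee_fin normal_pdf_ge0.
Qed.

End standard_normal.

(** * Standard normal random variables: rotations, normalised sums, tails *)

Section standard_normal_variables.
Context (R : realType) (d : measure_display) (T : measurableType d).
Variable P : probability T R.
Local Notation gam := (normal_prob (0 : R) 1).

Definition standard_normal (X : T -> R) : Prop :=
  measurable_fun setT X /\
  forall B : set R, measurable B -> P (X @^-1` B) = gam B.

Lemma integral_standard_normal (X : T -> R) (f : R -> \bar R) :
  standard_normal X -> measurable_fun setT f -> (forall x, 0 <= f x)%E ->
  (\int[P]_w f (X w) = \int[gam]_x f x)%E.
Proof.
move=> [mX lawX] mf f0.
pose X' := to_mfun mX.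
transitivity (\int[distribution P X']_x f x)%E.
  by rewrite ge0_integral_distribution.
by apply: eq_measure_integral => A mA _; exact: lawX.
Qed.

Lemma standard_normal_rot (X Y : T -> R) (c s : R) :
  standard_normal X -> standard_normal Y -> indep_pair P X Y ->
  0 < s -> c ^+ 2 + s ^+ 2 = 1 ->
  standard_normal (fun w => c * X w + s * Y w).
Proof.
move=> nX nY indXY s0 cs; split.
  by apply: measurable_funD; apply: measurable_funM => //; [exact: nX.1 | exact: nY.1].
move=> B mB.
pose X' := to_mfun nX.1.
pose Y' := to_mfun nY.1.
pose F (z : R * R) : \bar R := (\1_B (c * z.1 + s * z.2))%:E.
have mBE : measurable_fun setT (fun x : R => (\1_B x)%:E : \bar R).
  by apply/measurable_EFinP.
have mlin : measurable_fun [set: R * R] (fun z : R * R => c * z.1 + s * z.2).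
  by apply: measurable_funD; apply: measurable_funM.
have mF : measurable_fun [set: R * R] F by exact: measurableT_comp mBE mlin.
have F0 z : (0 <= F z)%E by rewrite lee_fin.
have mpre : measurable ((fun w => c * X w + s * Y w) @^-1` B).
  rewrite -[X in measurable X]setTI.
  by apply: measurable_funD => //; apply: measurable_funM => //; [exact: nX.1 | exact: nY.1].
transitivity (\int[P]_w F (X' w, Y' w))%E.
  rewrite [RHS](_ : _ = \int[P]_w (\1_((fun w => c * X w + s * Y w) @^-1` B) w)%:E)%E//.
  by rewrite integral_indic// setIT.
rewrite integral_indep_pair//.
transitivity (\int[distribution P X']_x \int[gam]_y F (x, y))%E.
  apply: eq_integral => x _; apply: eq_measure_integral => A mA _.
  exact: nY.2.
transitivity (\int[gam]_x \int[gam]_y F (x, y))%E.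
  by apply: eq_measure_integral => A mA _; exact: nX.2.
transitivity (\int[gam]_x (\1_B x)%:E)%E; last by rewrite integral_indic// setIT.
by rewrite -(@integral_standard_normal_rot _ c s (fun x => (\1_B x)%:E)).
Qed.

(** Peeling one term off a normalised sum of [m + 1] terms leaves a rotation with
    [c = sqrt (m / (m + 1))] and [s = 1 / sqrt (m + 1)]. *)
Lemma standard_normal_sum (I : finType) (W : I -> T -> R) (S : {set I}) :
  indep_family P W -> (forall k, k \in S -> standard_normal (W k)) ->
  (0 < #|S|)%N ->
  standard_normal (fun w => (Num.sqrt #|S|%:R)^-1 * \sum_(k in S) W k w).
Proof.
move=> indW nW S0.
suff H (k : I) (s : seq I) : uniq (k :: s) -> (forall j, j \in k :: s -> standard_normal (W j)) ->
    standard_normal (fun w => (Num.sqrt (size s).+1%:R)^-1 * \sum_(j <- k :: s) W j w).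
  have := enum_uniq (mem S); have : forall j, j \in enum S -> standard_normal (W j).
    by move=> j; rewrite mem_enum; exact: nW.
  move: S0; rewrite cardE; under eq_fun do rewrite -big_enum.
  by case: (enum S) => // k s _ nks uks; exact: H.
elim: s k => [k _ nW1|j s IH k uks nks].
  under eq_fun do rewrite big_seq1 sqrtr1 invr1 mul1r.
  by apply: nW1; rewrite mem_head.
have [kjs ujs] : k \notin j :: s /\ uniq (j :: s) by move: uks => /= /andP[].
pose V (b : bool) w := if b then W k w else
  (Num.sqrt (size s).+1%:R)^-1 * \sum_(i <- j :: s) W i w.
have indV : indep_family P V.
  apply: (indep_family_blocks (f := fun i => i == k) indW) => -[].
    by apply: block_measurable_coord; rewrite eqxx.
  apply: measurable_funM => //.
  (* [measurable_sum] wants every summand measurable for the block, so the variable [W k], which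
     does not occur in the sum, is replaced by zero. *)
  pose W' i := if i == k then cst 0 else W i.
  rewrite (_ : (fun w => _) = fun w => \sum_(i <- j :: s) W' i w); last first.
    apply/funext => w; rewrite !big_seq; apply: eq_bigr => i ijs.
    by rewrite /W'; case: eqP => // ik; rewrite -ik ijs in kjs.
  apply: measurable_sum => i; rewrite /W'; case: eqP => // ik.
  by apply: block_measurable_coord; exact/eqP.
pose m : R := (size s).+1%:R.
have m0 : 0 < m by rewrite ltr0n.
have m1 : (size (j :: s)).+1%:R = m + 1 by rewrite /m /= natr1.
rewrite m1.
have -> : (fun w => (Num.sqrt (m + 1))^-1 * \sum_(i <- [:: k, j & s]) W i w) =
    (fun w => (Num.sqrt m / Num.sqrt (m + 1)) * V false w +
              (Num.sqrt (m + 1))^-1 * V true w).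
  apply/funext => w; rewrite big_cons /V mulrDr addrC; congr (_ + _).
  by rewrite [RHS]mulrA -/m [_ / _ / _]mulrAC divff ?mul1r// gt_eqF// sqrtr_gt0.
apply: standard_normal_rot.
- by apply: IH => // i ijs; apply: nks; rewrite in_cons ijs orbT.
- by apply: nks; rewrite mem_head.
- by apply: (indep_family_pair indV).
- by rewrite invr_gt0 sqrtr_gt0 addr_gt0.
- rewrite exprMn exprVn !sqr_sqrtr ?ltW// ?addr_gt0//.
  by field; rewrite gt_eqF// addr_gt0.
Qed.

(** Chernoff bound at the optimal parameter [t], for both tails at once: the indicator is at most
    [exp (- t ^ 2) (exp (t X) + exp (- t X))]. *)
Lemma standard_normal_tail (X : T -> R) (t : R) : standard_normal X -> 0 <= t ->
  (P [set w | t <= `|X w|]%R <= (2 * expR (- (t ^+ 2 / 2)))%:E)%E.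
Proof.
move=> nX t0.
have mf : measurable_fun setT (fun x : R => expR (- t ^+ 2) *
   (expR (t * x) + expR (- t * x))).
  apply: measurable_funM => //; apply: measurable_funD;
  apply: measurableT_comp => //; exact: measurable_funM.
have mA : measurable [set w | t <= `|X w|].
  rewrite -[X in measurable X]setTI.
  apply: (measurable_fun_le measurableT) => //=; apply: measurableT_comp => //; exact: nX.1.
rewrite (_ : P _ = \int[P]_w (\1_([set w | t <= `|X w|]%R) w)%:E)%E; last first.
  by rewrite integral_indic// setIT.
apply: (@le_trans _ _ (\int[P]_w (expR (- t ^+ 2) *
   (expR (t * X w) + expR (- t * X w)))%:E)%E).
  apply: ge0_le_integral => //.
  - by apply/measurable_EFinP; exact: measurable_indic.
  - apply/measurable_EFinP; exact: measurableT_comp mf nX.1.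
  - move=> w _; rewrite lee_fin indicE; case: (boolP (w \in _)) => [|_]; last first.
      by rewrite mulr_ge0 ?expR_ge0// addr_ge0 ?expR_ge0.
    rewrite inE/= => tX; rewrite mulrDr -!expRD.
    have /orP[X0|X0] := le_total 0 (X w).
      rewrite -[leLHS]addr0 lerD ?expR_ge0// -[leLHS]expR0 ler_expR.
      by rewrite ger0_norm// in tX; nra.
    rewrite -[leLHS]add0r lerD ?expR_ge0// -[leLHS]expR0 ler_expR.
    by rewrite ler0_norm// in tX; nra.
rewrite (@integral_standard_normal X (fun x => (expR (- t ^+ 2) *
   (expR (t * x) + expR (- t * x)))%:E) nX); first last.
- by move=> x; rewrite lee_fin mulr_ge0 ?expR_ge0// addr_ge0 ?expR_ge0.
- by apply/measurable_EFinP.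
under eq_integral do rewrite EFinM EFinD.
have mexp (a : R) : measurable_fun setT (fun x : R => (expR (a * x))%:E).
  by apply/measurable_EFinP; apply: measurableT_comp => //; exact: measurable_funM.
rewrite ge0_integralZl ?lee_fin ?expR_ge0//; last 2 first.
- by apply: emeasurable_funD; exact: mexp.
- by move=> x _; rewrite adde_ge0// lee_fin expR_ge0.
rewrite ge0_integralD//; last 2 first.
- exact: mexp.
- exact: mexp.
rewrite !mgf_standard_normal sqrrN -EFinD -EFinM lee_fin.
rewrite -mulr2n -[_ *+ 2]mulr_natl mulrCA -expRD.
rewrite (_ : - t ^+ 2 + t ^+ 2 / 2 = - (t ^+ 2 / 2))//; by field.
Qed.

End standard_normal_variables.

(** * Absolute value of a shifted normal variable *)

(** Monotonicity of [cosh] in the absolute value: for nonnegative arguments the difference factors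
    as [(e^b - e^a) (1 - e^(-a) e^(-b))]. *)
Lemma expR_sym_le (R : realType) (a b : R) : `|a| <= `|b| ->
  expR a + expR (- a) <= expR b + expR (- b).
Proof.
have symE (x : R) : expR x + expR (- x) = expR `|x| + expR (- `|x|).
  have /orP[x0|x0] := le_total 0 x; first by rewrite ger0_norm.
  by rewrite ler0_norm// opprK addrC.
move=> ab; rewrite symE [leRHS]symE.
have a0 : 0 <= `|a| by [].
move: `|a| `|b| a0 ab => {}a {}b a0 ab.
rewrite -subr_ge0 (_ : _ - _ = (expR b - expR a) * (1 - expR (- a) * expR (- b))).
  apply: mulr_ge0; first by rewrite subr_ge0 ler_expR.
  by rewrite subr_ge0 -expRD -expR0 ler_expR; lra.
transitivity (expR b - expR a - (expR b * expR (- b)) * expR (- a) +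
    (expR a * expR (- a)) * expR (- b)); last by ring.
by rewrite !expRxMexpNx_1; ring.
Qed.

(* Jensen's inequality, from the tangent line of [expR] at [a * m]. *)
Lemma expR_integral_le (R : realType) d (T : measurableType d)
    (P : probability T R) (X : T -> R) (a m : R) :
  measurable_fun setT X -> (forall w, 0 <= X w) ->
  (\int[P]_w (X w)%:E = m%:E)%E ->
  ((expR (a * m))%:E <= \int[P]_w (expR (a * X w))%:E)%E.
Proof.
move=> mX X0 Xm.
have mexp : measurable_fun setT (fun w => (expR (a * X w))%:E).
  by apply/measurable_EFinP; apply: measurableT_comp => //; exact: measurable_funM.
have mXE : measurable_fun setT (fun w => (X w)%:E) by exact/measurable_EFinP.
have tangent w : expR (a * m) * (1 + a * X w - a * m) <= expR (a * X w).
  rewrite -[leRHS](divfK (_ : expR (a * m) != 0)) ?expR_eq0// -expRB mulrC.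
  by rewrite ler_pM2r ?expR_gt0//; have := expR_ge1Dx (a * X w - a * m); lra.
have cst_int (r : R) : (\int[P]_w r%:E = r%:E)%E.
  by rewrite integral_cst// -[RHS]mule1; congr (_ * _)%E; exact: probability_setT.
have X_int (r : R) : 0 <= r -> (\int[P]_w (r * X w)%:E = (r * m)%:E)%E.
  move=> r0; under eq_integral do rewrite EFinM.
  by rewrite ge0_integralZl ?Xm//; move=> w _; rewrite lee_fin.
have mrX (r : R) : measurable_fun setT (fun w => (r * X w)%:E).
  by apply/measurable_EFinP; exact: measurable_funM.
have e0 := expR_gt0 (a * m).
have eX0 w : (0 <= (expR (a * X w))%:E)%E by rewrite lee_fin expR_ge0.
have m0 : 0 <= m by rewrite -lee_fin -Xm; apply: integral_ge0 => w _; rewrite lee_fin.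
(* Only nonnegative functions are integrated, so the negative terms of the tangent line move to the
   other side; which ones they are depends on the sign of [a]. *)
have /orP[a0|a0] := le_total 0 a.
  have h : ((expR (a * m) * (1 + a * m))%:E <=
      \int[P]_w (expR (a * X w))%:E + (expR (a * m) * (a * m))%:E)%E.
    rewrite -(cst_int (expR (a * m) * (a * m))) -ge0_integralD//; last first.
      by move=> w _; rewrite lee_fin !mulr_ge0// ltW.
    apply: (@le_trans _ _ (\int[P]_w ((expR (a * m))%:E + (expR (a * m) * a * X w)%:E))%E).
      rewrite ge0_integralD//; last by move=> w _; rewrite lee_fin !mulr_ge0// ltW.
      rewrite cst_int X_int; last by rewrite mulr_ge0// ltW.
      by rewrite -EFinD lee_fin mulrDr mulr1 mulrA.
    apply: ge0_le_integral => //.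
    - by move=> w _; rewrite -EFinD lee_fin addr_ge0 ?mulr_ge0// ltW.
    - exact: emeasurable_funD.
    - exact: emeasurable_funD.
    - by move=> w _; rewrite -!EFinD lee_fin; have := tangent w; nra.
  move: h; case: (\int[P]_w _)%E => [r| |]//=; rewrite ?lee_fin ?leey//.
  by lra.
have h : ((expR (a * m) + expR (a * m) * (- a) * m)%:E <=
    \int[P]_w (expR (a * X w))%:E + (expR (a * m) * (- a) * m)%:E)%E.
  rewrite -(X_int (expR (a * m) * - a)); last by rewrite mulr_ge0 ?oppr_ge0 ?expR_ge0.
  rewrite -ge0_integralD//; last first.
    by move=> w _; rewrite lee_fin !mulr_ge0 ?oppr_ge0// ltW.
  rewrite -cst_int; apply: ge0_le_integral => //.
  - by move=> w _; rewrite lee_fin addr_ge0 ?mulr_ge0 ?oppr_ge0 ?expR_ge0.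
  - exact: emeasurable_funD.
  - by move=> w _; rewrite -!EFinD lee_fin; have := tangent w; nra.
move: h; case: (\int[P]_w _)%E => [r| |]//=; rewrite ?lee_fin ?leey//.
by lra.
Qed.

Section folded_normal.
Context (R : realType).
Local Notation gam := (normal_prob (0 : R) 1).

(** The function [h] of the overview. [fine] loses nothing, the integral being finite by
    [folded_meanE]. *)
Definition folded_mean (u : R) : R := fine (\int[gam]_x `|u + x|%:E)%E.

Let mabs (u : R) : measurable_fun setT (fun x : R => `|u + x|).
Proof. by apply: measurableT_comp => //; apply: measurable_funD. Qed.

Let mexp (f : R -> R) : measurable_fun setT f ->
  measurable_fun setT (fun x => (expR (f x))%:E : \bar R).
Proof. by move=> mf; apply/measurable_EFinP; exact: measurableT_comp. Qed.

Lemma folded_meanE (u : R) : (\int[gam]_x `|u + x|%:E = (folded_mean u)%:E)%E.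
Proof.
rewrite /folded_mean fineK// ge0_fin_numE; last by apply: integral_ge0 => x _; rewrite lee_fin.
(* Finiteness follows from [|y| <= e^y + e^(-y)] at [y = u + x], as both exponentials have a finite
   Gaussian integral. *)
apply: (@le_lt_trans _ _ (\int[gam]_x ((expR u)%:E * (expR (1 * x))%:E +
  (expR (- u))%:E * (expR (- 1 * x))%:E))%E); last first.
  have m1 (a b : R) : measurable_fun setT (fun x : R => (expR a)%:E * (expR (b * x))%:E : \bar R)%E.
    apply: emeasurable_funM => //; apply: mexp; exact: measurable_funM.
  have p1 (a b x : R) : (0 <= (expR a)%:E * (expR (b * x))%:E)%E.
    by rewrite mule_ge0// lee_fin expR_ge0.
  have e1 (a b : R) : (\int[gam]_x ((expR a)%:E * (expR (b * x))%:E) < +oo)%E.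
    rewrite ge0_integralZl//; last by apply: mexp; exact: measurable_funM.
    by rewrite mgf_standard_normal -EFinM ltry.
  by rewrite ge0_integralD//; [exact: lte_add_pinfty | exact: m1 | exact: m1].
apply: ge0_le_integral => //.
- by apply/measurable_EFinP; exact: mabs.
- by apply: emeasurable_funD; apply: emeasurable_funM => //; apply: mexp; exact: measurable_funM.
- move=> x _; rewrite -!EFinM -!EFinD lee_fin -!expRD mul1r mulN1r -opprD.
  have := expR_sym_le (lexx `|u + x|); have := expR_ge1Dx (u + x).
  have := expR_ge1Dx (- (u + x)); have := expR_gt0 (u + x); have := expR_gt0 (- (u + x)).
  by have /orP[h|h] := le_total 0 (u + x); rewrite ?(ger0_norm h) ?(ler0_norm h); lra.
Qed.

(* Symmetrisation: with [y] an independent copy of [x],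
   [E exp (l (|u + x| - |u + y|)) = E cosh (l (|u + x| - |u + y|))], which
   increases when [||u + x| - |u + y||] is replaced with [|x - y|]. *)
Lemma folded_mgf (u l : R) :
  (\int[gam]_x (expR (l * `|u + x|))%:E <=
   (expR (l * folded_mean u + l ^+ 2))%:E)%E.
Proof.
pose A := (\int[gam]_x (expR (l * `|u + x|))%:E)%E.
pose B := (\int[gam]_x (expR (- l * `|u + x|))%:E)%E.
have mA k : measurable_fun setT (fun x : R => (expR (k * `|u + x|))%:E : \bar R).
  by apply: mexp; apply: measurable_funM => //; exact: mabs.
have A0 : (0 <= A)%E by apply: integral_ge0 => x _; rewrite lee_fin expR_ge0.
have B0 : (0 <= B)%E by apply: integral_ge0 => x _; rewrite lee_fin expR_ge0.
(* Jensen bounds the factor of the independent copy from below; cancelling it against the bound on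
   [A * B] isolates [A]. *)
have eB : ((expR (- l * folded_mean u))%:E <= B)%E.
  apply: (@expR_integral_le _ _ _ gam (fun x => `|u + x|)) => //.
    exact: mabs.
  exact: folded_meanE.
have swap_int (H : R * R -> \bar R) : measurable_fun [set: R * R] H ->
    (forall z, 0 <= H z)%E ->
    (\int[gam]_x \int[gam]_y (H (x, y) + H (y, x)) =
     2%:E * \int[gam]_x \int[gam]_y H (x, y))%E.
  move=> mH H0.
  have m1 x : measurable_fun setT (fun y => H (x, y)) by exact: measurableT_comp mH _.
  have m2 x : measurable_fun setT (fun y => H (y, x)) by exact: measurableT_comp mH _.
  transitivity (\int[gam]_x (\int[gam]_y H (x, y) + \int[gam]_y H (y, x)))%E.
    by apply: eq_integral => x _; rewrite ge0_integralD//; [exact: m1 | exact: m2].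
  rewrite ge0_integralD//; first last.
  - exact: (@measurable_fun_fubini_tonelli_G _ _ (measurableTypeR R) (measurableTypeR R) R gam H).
  - by move=> x _; apply: integral_ge0.
  - exact: (@measurable_fun_fubini_tonelli_F _ _ (measurableTypeR R) (measurableTypeR R) R gam H).
  - by move=> x _; apply: integral_ge0.
  rewrite [X in (_ + X)%E](_ : _ = \int[gam]_x \int[gam]_y H (x, y))%E; last first.
    by rewrite (@fubini_tonelli _ _ _ _ R gam gam H).
  rewrite -mule2n; exact/esym/mule_natl.
(* Exchanging [x] and [y] preserves the double integral, so comparing the symmetrised integrands is
   enough. *)
have le_sym (F G : R * R -> \bar R) : measurable_fun [set: R * R] F ->
    measurable_fun [set: R * R] G -> (forall z, 0 <= F z)%E -> (forall z, 0 <= G z)%E ->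
    (forall x y, F (x, y) + F (y, x) <= G (x, y) + G (y, x))%E ->
    (\int[gam]_x \int[gam]_y F (x, y) <= \int[gam]_x \int[gam]_y G (x, y))%E.
  move=> mF mG F0 G0 FG.
  rewrite -(@lee_pmul2l _ 2%:E)// -(swap_int F mF F0) -(swap_int G mG G0).
  have madd (H : R * R -> \bar R) : measurable_fun [set: R * R] H ->
      (forall z, 0 <= H z)%E ->
      measurable_fun setT (fun x => \int[gam]_y (H (x, y) + H (y, x)))%E.
    move=> mH H0.
    have mHH : measurable_fun [set: R * R] (fun z => H z + H (z.2, z.1))%E.
      by apply: emeasurable_funD => //; apply: measurableT_comp mH _; exact: measurable_swap.
    have HH0 z : (0 <= H z + H (z.2, z.1))%E by rewrite adde_ge0.
    exact: (@measurable_fun_fubini_tonelli_F _ _ (measurableTypeR R) (measurableTypeR R) R gam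
      (fun z => H z + H (z.2, z.1))%E).
  apply: ge0_le_integral => //.
  - by move=> x _; apply: integral_ge0 => y _; rewrite adde_ge0.
  - exact: madd.
  - exact: madd.
  move=> x _; apply: ge0_le_integral => //.
  - by move=> y _; rewrite adde_ge0.
  - by apply: emeasurable_funD; apply: measurableT_comp mF _.
  - by apply: emeasurable_funD; apply: measurableT_comp mG _.
pose F (z : R * R) : \bar R := (expR (l * `|u + z.1|) * expR (- l * `|u + z.2|))%:E.
pose G (z : R * R) : \bar R := (expR (l * z.1) * expR (- l * z.2))%:E.
have mprod (f g : R -> R) : measurable_fun setT f -> measurable_fun setT g ->
    measurable_fun [set: R * R] (fun z => (expR (f z.1) * expR (g z.2))%:E : \bar R).
  move=> mf mg; apply/measurable_EFinP; apply: measurable_funM;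
    by apply: measurableT_comp => //; apply: measurableT_comp.
have mF : measurable_fun [set: R * R] F.
  by apply: (mprod (fun x => l * `|u + x|) (fun x => - l * `|u + x|));
    apply: measurable_funM => //; exact: mabs.
have mG : measurable_fun [set: R * R] G.
  by apply: (mprod (fun x => l * x) (fun x => - l * x)); apply: measurable_funM.
have F0 z : (0 <= F z)%E by rewrite lee_fin mulr_ge0 ?expR_ge0.
have G0 z : (0 <= G z)%E by rewrite lee_fin mulr_ge0 ?expR_ge0.
have prodE (f g : R -> R) : measurable_fun setT f -> measurable_fun setT g ->
    (\int[gam]_x \int[gam]_y (expR (f x) * expR (g y))%:E =
     (\int[gam]_x (expR (f x))%:E) * (\int[gam]_x (expR (g x))%:E))%E.
  move=> mf mg.
  have I0 h : (0 <= \int[gam]_x (expR (h x))%:E)%E.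
    by apply: integral_ge0 => x _; rewrite lee_fin expR_ge0.
  transitivity (\int[gam]_x ((expR (f x))%:E * \int[gam]_y (expR (g y))%:E))%E.
    apply: eq_integral => x _; under eq_integral do rewrite EFinM.
    by rewrite ge0_integralZl//; exact: mexp.
  rewrite ge0_integralZr; [by []|exact: measurableT|exact: mexp| |exact: I0].
  by move=> x _; rewrite lee_fin expR_ge0.
have iF : (\int[gam]_x \int[gam]_y F (x, y) = A * B)%E.
  by apply: (prodE (fun x => l * `|u + x|) (fun x => - l * `|u + x|));
    apply: measurable_funM => //; exact: mabs.
(* The variable and its copy contribute [l ^ 2 / 2] each; this doubling is the price of
   symmetrisation. *)
have iG : (\int[gam]_x \int[gam]_y G (x, y) = (expR (l ^+ 2))%:E)%E.
  rewrite /G/= (prodE (fun x => l * x) (fun x => - l * x)); last 2 first.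
  - exact: measurable_funM.
  - exact: measurable_funM.
  by rewrite !mgf_standard_normal -EFinM -expRD; congr (expR _)%:E; field.
have AB : (A * B <= (expR (l ^+ 2))%:E)%E.
  rewrite -iF -iG; apply: le_sym => // x y.
  rewrite /F /G/= -!EFinD lee_fin -!expRD.
  have -> : l * `|u + y| + - l * `|u + x| = - (l * `|u + x| + - l * `|u + y|) by ring.
  have -> : l * y + - l * x = - (l * x + - l * y) by ring.
  apply: expR_sym_le; rewrite !mulNr -!mulrBr !normrM ler_wpM2l//.
  by apply: le_trans (ler_dist_dist _ _) _; rewrite opprD addrACA subrr add0r.
rewrite -/A.
have e0 : (0 < (expR (- l * folded_mean u))%:E)%E by rewrite lte_fin expR_gt0.
rewrite -(@lee_pmul2r _ (expR (- l * folded_mean u))%:E)//.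
rewrite -EFinM -expRD mulNr addrAC addrN add0r.
by apply: le_trans AB; rewrite lee_wpmul2l// -mulNr.
Qed.

End folded_normal.

Section folded_mean_increase.
Context (R : realType).
Local Notation gam := (normal_prob (0 : R) 1).
Local Notation leb := (@lebesgue_measure R).

(* Averaging over [x] and [- x], as [(|u + x| + |u - x|) / 2 = max u |x|]. *)
Lemma folded_mean_max (u : R) : 0 <= u ->
  (\int[gam]_x (Num.max u `|x|)%:E = (folded_mean u)%:E)%E.
Proof.
move=> u0.
have mabs s : measurable_fun setT (fun x : R => `|u + s * x|%:E : \bar R).
  apply/measurable_EFinP; apply: measurableT_comp => //; apply: measurable_funD => //.
have mmax : measurable_fun setT (fun x : R => (Num.max u `|x|)%:E : \bar R).
  by apply/measurable_EFinP; apply: measurable_maxr => //; exact: measurableT_comp.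
have max0 (x : R) : (0 <= (Num.max u `|x|)%:E)%E by rewrite lee_fin le_max u0.
have abs1 s (x : R) : (0 <= `|u + s * x|%:E)%E by rewrite lee_fin.
have h1 : (\int[gam]_x `|u + 1 * x|%:E = (folded_mean u)%:E)%E.
  by rewrite -folded_meanE; apply: eq_integral => x _; rewrite mul1r.
have h2 : (\int[gam]_x `|u + -1 * x|%:E = (folded_mean u)%:E)%E.
  rewrite -h1 -(@ge0_integral_standard_normalN _ (fun x => `|u + 1 * x|%:E)%E)//.
  by apply: eq_integral => x _; rewrite mul1r mulN1r.
have : (2%:E * \int[gam]_x (Num.max u `|x|)%:E = (2 * folded_mean u)%:E)%E.
  transitivity (\int[gam]_x (2%:E * (Num.max u `|x|)%:E))%E.
    by rewrite ge0_integralZl.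
  transitivity (\int[gam]_x (`|u + 1 * x|%:E + `|u + -1 * x|%:E))%E.
    apply: eq_integral => x _; rewrite -EFinD -EFinM mul1r mulN1r; congr EFin.
    have [x0|x0] := leP 0 x; [rewrite (ger0_norm x0)|rewrite (ltr0_norm x0)].
      rewrite (ger0_norm (addr_ge0 u0 x0)).
      have [h|h] := leP u x; first by rewrite ler0_norm ?subr_le0//; ring.
      by rewrite ger0_norm ?subr_ge0 ?ltW//; ring.
    rewrite (_ : `|u - x| = u - x); last by rewrite ger0_norm//; lra.
    have [h|h] := leP u (- x); first by rewrite ler0_norm; [ring | lra].
    by rewrite ger0_norm; [ring | lra].
  rewrite ge0_integralD//; [|exact: mabs|exact: mabs].
  by rewrite h1 h2 -EFinD; congr EFin; ring.
have : (0 <= \int[gam]_x (Num.max u `|x|)%:E)%E by apply: integral_ge0.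
case: (\int[gam]_x (Num.max u `|x|)%:E)%E => [r _|_|]//.
  by rewrite -EFinM => -[] h; congr EFin; apply: (@mulfI _ 2).
by rewrite gt0_muley.
Qed.

(** On the interval the density is at least its value at 1, because [a <= 1]. *)
Lemma normal_small_ball (a : R) : 0 <= a <= 1 ->
  ((2 * normal_pdf 0 1 1 * a)%:E <= gam `[(- a)%R, a])%E.
Proof.
move=> /andP[a0 a1].
have -> : (2 * normal_pdf 0 1 1 * a)%:E = (\int[leb]_(x in `[(- a)%R, a]) (normal_pdf 0 1 1)%:E)%E.
  rewrite integral_cst//= lebesgue_measure_itv/= lte_fin.
  have [aa|aa] := ltP (- a) a.
    by rewrite -EFinB -EFinM; congr EFin; ring.
  have -> : a = 0 by lra.
  by rewrite mulr0 mule0.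
apply: ge0_le_integral => //.
- by move=> x _; rewrite lee_fin normal_pdf_ge0.
- by apply/measurable_EFinP; apply: measurable_funTS; exact: measurable_normal_pdf.
- move=> x /=; rewrite in_itv/= => /andP[x1 x2]; rewrite lee_fin !normal_pdfE1//.
  rewrite ler_wpM2l ?normal_peak_ge0// ler_expR !mulNr lerN2 ler_wpM2r//.
  by rewrite !subr0; nra.
Qed.

(** [max v |x| - max u |x|] is nonnegative and equals [v - u] when [|x| <= u]. Keeping only
    [|x| <= min u 1], the small ball bound gives the probability of that event. *)
Lemma folded_mean_increase (u v : R) : 0 <= u -> u <= v ->
  2 * normal_pdf 0 1 1 * Num.min u 1 * (v - u) <= folded_mean v - folded_mean u.
Proof.
move=> u0 uv.
have v0 : 0 <= v by exact: le_trans uv.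
set m := Num.min u 1.
have m01 : 0 <= m <= 1 by rewrite /m le_min u0 ler01 ge_min lexx orbT.
have mu : m <= u by rewrite /m ge_min lexx.
rewrite lerBrDl -lee_fin EFinD -!folded_mean_max//.
have mmax (w : R) : measurable_fun setT (fun x : R => (Num.max w `|x|)%:E : \bar R).
  by apply/measurable_EFinP; apply: measurable_maxr => //; exact: measurableT_comp.
have mind : measurable_fun setT (fun x : R => (\1_(`[(- m)%R, m]%classic : set R) x)%:E : \bar R).
  by apply/measurable_EFinP; exact: measurable_indic.
apply: (@le_trans _ _ (\int[gam]_x ((Num.max u `|x|)%:E +
    (v - u)%:E * (\1_(`[(- m)%R, m]%classic : set R) x)%:E))%E).
  rewrite ge0_integralD; [|exact: measurableT| | exact: mmax | | by apply: emeasurable_funM].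
  - rewrite leeD2l// ge0_integralZl//; last by rewrite lee_fin subr_ge0.
    rewrite integral_indic// setIT mulrC EFinM lee_wpmul2l ?lee_fin ?subr_ge0//.
    exact: normal_small_ball.
  - by move=> x _; rewrite lee_fin le_max u0.
  - by move=> x _; rewrite -EFinM lee_fin mulr_ge0// subr_ge0.
apply: ge0_le_integral => //.
- by move=> x _; rewrite -EFinM -EFinD lee_fin addr_ge0 ?le_max ?u0// mulr_ge0// subr_ge0.
- by apply: emeasurable_funD; [exact: mmax | apply: emeasurable_funM].
- exact: mmax.
- move=> x _; rewrite -EFinM -EFinD lee_fin indicE.
  case: (boolP (x \in _)) => [|_]; last first.
    by rewrite mulr0 addr0 ge_max !le_max uv lexx orbT.
  rewrite inE/= in_itv/= => xm; rewrite mulr1.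
  have xu : `|x| <= u by rewrite ler_norml; apply/andP; split; lra.
  by rewrite (max_idPl xu) (max_idPl (le_trans xu uv)); lra.
Qed.

Lemma folded_mean_le (u v : R) : 0 <= u -> u <= v -> folded_mean u <= folded_mean v.
Proof.
move=> u0 uv; rewrite -subr_ge0; apply: le_trans (folded_mean_increase u0 uv).
by rewrite !mulr_ge0 ?normal_pdf_ge0 ?subr_ge0// le_min u0 ler01.
Qed.

End folded_mean_increase.

(** * Chernoff bounds *)

Lemma lee_prode (R : realDomainType) (I : Type) (s : seq I) (f g : I -> \bar R) :
  (forall i, 0 <= f i <= g i)%E -> (\prod_(i <- s) f i <= \prod_(i <- s) g i)%E.
Proof.
move=> fg; suff /andP[] : (0 <= \prod_(i <- s) f i <= \prod_(i <- s) g i)%E by [].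
elim/big_ind2: _ => [|x1 x2 y1 y2 /andP[x10 x12] /andP[y10 y12]|i _]; last exact: fg.
  by rewrite lee01 lexx.
by rewrite mule_ge0//=; exact: lee_pmul.
Qed.

Section chernoff_bounds.
Context (R : realType) (d : measure_display) (T : measurableType d).
Variable P : probability T R.
Local Notation gam := (normal_prob (0 : R) 1).

Lemma probability_le_integral (A : set T) (f : T -> R) : measurable A ->
  measurable_fun setT f -> (forall w, 0 <= f w) -> (forall w, A w -> 1 <= f w) ->
  (P A <= \int[P]_w (f w)%:E)%E.
Proof.
move=> mA mf f0 Af.
rewrite (_ : P A = \int[P]_w (\1_A w)%:E)%E; last by rewrite integral_indic// setIT.
apply: ge0_le_integral => //.
- by apply/measurable_EFinP; exact: measurable_indic.
- by apply/measurable_EFinP.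
- move=> w _; rewrite lee_fin indicE; case: (boolP (w \in A)) => [|_]; last exact: f0.
  by rewrite inE => /Af.
Qed.

(* The event [E] is carried along as one more member of the family so that one
   can condition on the support of [mu]. *)
Lemma folded_chernoff (I : finType) (E : set T) (W : I -> T -> R) (u t c : R) :
  measurable E ->
  indep_family P (fun k : I + 'I_1 => if k is inl i then W i else \1_E) ->
  (forall i, standard_normal P (W i)) -> 0 <= t -> c ^+ 2 = 1 ->
  (P (E `&` [set w | #|I|%:R * t <=
        c * (\sum_i `|u + W i w| - #|I|%:R * folded_mean u)]%R) <=
   P E * (expR (- (#|I|%:R * t ^+ 2 / 4)))%:E)%E.
Proof.
move=> mE indW nW t0 c1.
set N : R := #|I|%:R; set h := folded_mean u.
(* [c] is a sign choosing between upper and lower deviations, and [t / 2] minimises the exponent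
   [s ^ 2 - s t]. *)
pose l := c * t / 2.
have mabs (k : R) : measurable_fun setT (fun x : R => expR (k * `|u + x|)).
  apply: measurableT_comp => //; apply: measurable_funM => //.
  by apply: measurableT_comp => //; apply: measurable_funD.
have msum : measurable_fun setT (fun w => \sum_i `|u + W i w|).
  apply: measurable_sum => i; apply: measurableT_comp => //.
  by apply: measurable_funD => //; exact: (nW i).1.
(* The product formula requires factors nonnegative on all of [R]; [Num.max 0] is the identity on
   the values of an indicator. *)
pose g (k : I + 'I_1) (x : R) : R := if k is inl i then expR (l * `|u + x|) else Num.max 0 x.
pose V (k : I + 'I_1) := if k is inl i then W i else \1_E.
have mg k : measurable_fun setT (g k).
  by case: k => i; [exact: mabs | exact: measurable_maxr].
have g0 k x : 0 <= g k x.
  by case: k => i; rewrite /g ?expR_ge0// le_max lexx.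
pose C := expR (- (N * (t ^+ 2 / 2) + l * (N * h))).
have mf : measurable_fun setT (fun w => C * \prod_k g k (V k w)).
  apply: measurable_funM => //; apply: measurable_prod => k _.
  by apply: measurableT_comp (mg k) _; exact: (indW.1 k).
have mlow : measurable [set w | N * t <= c * (\sum_i `|u + W i w| - N * h)].
  rewrite -[X in measurable X]setTI.
  by apply: (measurable_fun_le measurableT) => //; apply: measurable_funM => //;
    apply: measurable_funB.
apply: (@le_trans _ _ (\int[P]_w (C * \prod_k g k (V k w))%:E)%E).
  apply: probability_le_integral => //; first exact: measurableI.
    by move=> w; rewrite mulr_ge0 ?expR_ge0//; apply: prodr_ge0.
  move=> w [Ew /= cw]; rewrite big_sumType/= big_ord1 /g /V indicE mem_set//.
  rewrite (max_idPr ler01) mulr1 -expR_sum -mulr_sumr -expRD -[leLHS]expR0 ler_expR.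
  move: cw; set s := \sum_i _ => cw.
  have t2 : 0 <= t / 2 by rewrite divr_ge0.
  rewrite [leRHS](_ : _ = t / 2 * (c * (s - N * h)) - t / 2 * (N * t)).
    by rewrite subr_ge0 ler_wpM2l.
  by rewrite /l; field.
under eq_integral do rewrite EFinM.
rewrite ge0_integralZl//; last 3 first.
- apply/measurable_EFinP; apply: measurable_prod => k _.
  by apply: measurableT_comp (mg k) _; exact: (indW.1 k).
- by move=> w _; rewrite lee_fin; apply: prodr_ge0.
- by rewrite lee_fin expR_ge0.
rewrite (expectation_indep_prod indW mg g0) big_sumType/= big_ord1/=.
rewrite (_ : \int[P]_w _ = P E)%E; last first.
  transitivity (\int[P]_w (\1_E w)%:E)%E; last by rewrite integral_indic// setIT.
  by apply: eq_integral => w _; rewrite max_r// indicE.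
apply: (@le_trans _ _ (C%:E * ((\prod_(i : I) (expR (l * h + l ^+ 2))%:E) * P E))%E).
  rewrite lee_wpmul2l ?lee_fin ?expR_ge0// lee_wpmul2r//.
  apply: lee_prode => i; rewrite integral_ge0/=; last by move=> w _; rewrite lee_fin expR_ge0.
  rewrite (integral_standard_normal (f := fun x => (expR (l * `|u + x|))%:E) (nW i)).
  - exact: folded_mgf.
  - by apply/measurable_EFinP; exact: mabs.
  - by move=> x; rewrite lee_fin expR_ge0.
rewrite muleA muleC lee_wpmul2l//.
rewrite prodEFin -EFinM lee_fin prodr_const -expRM_natl -expRD ler_expR cardT -cardE -/N.
rewrite /l !exprMn c1 exprVn.
lra.
Qed.

End chernoff_bounds.

(** * Counting nonzero variables: mean and lower tail *)

Section bernoulli_sums.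
Context (R : realType) (d : measure_display) (T : measurableType d).
Variable P : probability T R.

Lemma measurable_nonzero : measurable_fun setT (fun x : R => (x != 0)%:R : R).
Proof.
rewrite (_ : (fun x => _) = \1_(~` [set (0 : R)])).
  by apply: measurable_indic; apply: measurableC; exact: measurable_set1.
apply/funext => x; rewrite indicE.
have [->|/eqP x0] := eqVneq x 0; [by rewrite memNset//=; apply | by rewrite mem_set].
Qed.

Lemma probability_nonzero (X : T -> R) (e : R) : measurable_fun setT X ->
  P (X @^-1` [set 0]) = (1 - e)%:E -> P [set w | X w != 0] = e%:E.
Proof.
move=> mX X0.
have -> : [set w | X w != 0] = ~` (X @^-1` [set 0]).
  by apply/seteqP; split => w /eqP.
rewrite probability_setC.
  by rewrite X0 -EFinB; congr EFin; ring.
by rewrite -[X in measurable X]setTI; exact: mX.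
Qed.

Lemma integral_nonzero (X : T -> R) (a b e : R) : measurable_fun setT X ->
  P (X @^-1` [set 0]) = (1 - e)%:E -> 0 <= a -> 0 <= b ->
  (\int[P]_w (if X w != 0 then a else b)%:E = (a * e + b * (1 - e))%:E)%E.
Proof.
move=> mX X0 a0 b0.
have mZ : measurable (X @^-1` [set 0]) by rewrite -[X in measurable X]setTI; exact: mX.
have mN : measurable [set w | X w != 0].
  rewrite (_ : [set w | _] = ~` (X @^-1` [set 0])); first exact: measurableC.
  by apply/seteqP; split => w /eqP.
transitivity (\int[P]_w (a%:E * (\1_[set w | (X w != 0)%R] w)%:E +
    b%:E * (\1_(X @^-1` [set 0%R]) w)%:E))%E.
  apply: eq_integral => w _; rewrite -!EFinM -EFinD !indicE; congr EFin.
  have [Xw|Xw] := eqVneq (X w) 0.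
    by rewrite memNset ?mem_set//=; [ring | rewrite Xw eqxx].
  by rewrite mem_set// memNset//=; [ring | exact/eqP].
have mi (A : set T) (k : R) : measurable A ->
    measurable_fun setT (fun w => k%:E * (\1_A w)%:E : \bar R)%E.
  by move=> mA; apply: emeasurable_funM => //; apply/measurable_EFinP; exact: measurable_indic.
have ii (A : set T) (k : R) : measurable A -> 0 <= k ->
    (\int[P]_w (k%:E * (\1_A w)%:E) = k%:E * P A)%E.
  move=> mA k0; rewrite ge0_integralZl ?integral_indic ?setIT//.
  by apply/measurable_EFinP; exact: measurable_indic.
rewrite ge0_integralD//; [|by move=> w _; rewrite -EFinM lee_fin mulr_ge0|exact: mi
  |by move=> w _; rewrite -EFinM lee_fin mulr_ge0|exact: mi].
by rewrite !ii// (probability_nonzero mX X0) X0 -!EFinM -EFinD.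
Qed.

Lemma expectation_nonzero (I : finType) (W : I -> T -> R) (S : {set I}) (e : R) :
  (forall k, measurable_fun setT (W k)) ->
  (forall k, k \in S -> P (W k @^-1` [set 0]) = (1 - e)%:E) ->
  (\int[P]_w (\sum_(k in S) (W k w != 0)%:R)%:E = (#|S|%:R * e)%:E)%E.
Proof.
move=> mW W0.
pose f k w : R := if k \in S then (W k w != 0)%:R else 0.
transitivity (\int[P]_w (\sum_k (f k w)%:E))%E.
  by apply: eq_integral => w _; rewrite sumEFin [in LHS]big_mkcond.
have mf k : measurable_fun setT (fun w => (f k w)%:E : \bar R).
  apply/measurable_EFinP; rewrite /f; case: (k \in S) => //.
  exact: measurableT_comp measurable_nonzero (mW k).
rewrite ge0_integral_sum//; last by move=> k w _; rewrite lee_fin /f; case: ifP.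
rewrite (eq_bigr (fun k => (if k \in S then e else 0)%:E)).
  by rewrite sumEFin -big_mkcond/= sumr_const mulr_natl.
move=> k _; rewrite /f; case: ifP => kS; last by rewrite integral_cst// mul0e.
rewrite (_ : e = 1 * e + 0 * (1 - e)); last by ring.
rewrite -(integral_nonzero (mW k) (W0 _ kS))//.
by apply: eq_integral => w _; case: (W k w != 0).
Qed.

(** Chernoff bound: each factor is [1 - e (1 - exp (- l)) <= exp (- e (l - l ^ 2))], and
    [l = dl / 2] minimises the resulting exponent [l ^ 2 - l dl]. *)
Lemma bernoulli_lower_tail (I : finType) (W : I -> T -> R) (S : {set I})
    (e dl : R) :
  indep_family P W -> (forall k, k \in S -> P (W k @^-1` [set 0]) = (1 - e)%:E) ->
  0 <= e -> 0 <= dl ->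
  (P [set w | \sum_(k in S) (W k w != 0)%:R <= (1 - dl) * (#|S|%:R * e)]%R <=
   (expR (- (#|S|%:R * e * dl ^+ 2 / 4)))%:E)%E.
Proof.
move=> indW W0 e0 dl0; set N : R := #|S|%:R.
pose l := dl / 2.
have l0 : 0 <= l by rewrite divr_ge0.
pose g k (x : R) : R := if k \in S then expR (- l * (x != 0)%:R) else 1.
have mg k : measurable_fun setT (g k).
  rewrite /g; case: (k \in S) => //; apply: measurableT_comp => //.
  by apply: measurable_funM => //; exact: measurable_nonzero.
have g0 k x : 0 <= g k x by rewrite /g; case: ifP => _; rewrite ?expR_ge0.
pose C := expR (l * ((1 - dl) * (N * e))).
have mgW k : measurable_fun setT (fun w => g k (W k w)).
  exact: measurableT_comp (mg k) (indW.1 k).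
have ms : measurable_fun setT (fun w => \sum_(k in S) (W k w != 0)%:R : R).
  rewrite (_ : (fun w => _) = fun w => \sum_k (if k \in S then (W k w != 0)%:R else 0)).
    apply: measurable_sum => k; case: (k \in S) => //.
    exact: measurableT_comp measurable_nonzero (indW.1 k).
  by apply/funext => w; rewrite big_mkcond.
apply: (@le_trans _ _ (\int[P]_w (C * \prod_k g k (W k w))%:E)%E).
  apply: probability_le_integral.
  - by rewrite -[X in measurable X]setTI; apply: (measurable_fun_le measurableT).
  - by apply: measurable_funM => //; apply: measurable_prod => k _; exact: mgW.
  - by move=> w; rewrite mulr_ge0 ?expR_ge0//; apply: prodr_ge0.
  move=> w /= sw; rewrite /g (_ : \prod_k _ = \prod_(k in S) expR (- l * (W k w != 0)%:R)).
    rewrite -expR_sum -mulr_sumr -expRD.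
    by rewrite -[leLHS]expR0 ler_expR mulNr -mulrBr mulr_ge0// subr_ge0.
  by rewrite [RHS]big_mkcond.
under eq_integral do rewrite EFinM.
rewrite ge0_integralZl//; last 3 first.
- by apply/measurable_EFinP; apply: measurable_prod => k _; exact: mgW.
- by move=> w _; rewrite lee_fin; apply: prodr_ge0.
- by rewrite lee_fin expR_ge0.
rewrite (expectation_indep_prod indW mg g0).
pose f k : R := if k \in S then expR (- (e * (l - l ^+ 2))) else 1.
apply: (@le_trans _ _ (C%:E * \prod_k (f k)%:E)%E).
  rewrite lee_wpmul2l ?lee_fin ?expR_ge0//.
  apply: lee_prode => k; rewrite integral_ge0/=; last by move=> w _; rewrite lee_fin.
  rewrite /f; have [kS|kS] := boolP (k \in S); last first.
    rewrite (_ : \int[P]_w _ = 1)%E//.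
    under eq_integral do rewrite /g (negbTE kS).
    by rewrite integral_cst// mul1e; exact: probability_setT.
  rewrite (_ : \int[P]_w _ = (expR (- l) * e + 1 * (1 - e))%:E)%E; last first.
    rewrite -(integral_nonzero (indW.1 k) (W0 _ kS))// ?expR_ge0//.
    apply: eq_integral => w _; rewrite /g kS; case: (W k w != 0) => /=.
      by rewrite mulr1.
    by rewrite mulr0 expR0.
  rewrite lee_fin; apply: le_trans (expR_ge1Dx _).
  (* From [exp l >= 1 + l] and [(1 - l + l ^ 2) (1 + l) = 1 + l ^ 3 >= 1]. *)
  have el : expR (- l) <= 1 - l + l ^+ 2.
    rewrite expRN -div1r ler_pdivrMr ?expR_gt0//.
    apply: (@le_trans _ _ ((1 - l + l ^+ 2) * (1 + l))).
      by rewrite -subr_ge0 (_ : _ - _ = l ^+ 3); [rewrite exprn_ge0 | ring].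
    by rewrite ler_wpM2l ?expR_ge1Dx//; nra.
  by have := ler_wpM2r e0 el; lra.
rewrite prodEFin -EFinM lee_fin (_ : \prod_k f k =
  \prod_(k in S) expR (- (e * (l - l ^+ 2)))); last by rewrite [RHS]big_mkcond.
rewrite prodr_const -expRM_natl -expRD ler_expR -/N.
by rewrite /l le_eqVlt; apply/orP; left; apply/eqP; field.
Qed.

End bernoulli_sums.

(** * The ARW model *)

Section random_signs.
Context (R : realType) (d : measure_display) (T : measurableType d).
Variable P : probability T R.
Local Notation gam := (normal_prob (0 : R) 1).

(** The model prescribes two point masses, so a label is a sign only almost surely. *)
Lemma fair_sign_ae (X : T -> R) : measurable_fun setT X ->
  P (X @^-1` [set 1]) = (2^-1)%:E -> P (X @^-1` [set -1]) = (2^-1)%:E ->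
  P (~` (X @^-1` [set 1] `|` X @^-1` [set -1])) = 0%E.
Proof.
move=> mX X1 XN1.
have m1 (x : R) : measurable (X @^-1` [set x]).
  by rewrite -[X in measurable X]setTI; exact: mX.
rewrite probability_setC; last exact: measurableU.
have PU : P (X @^-1` [set 1] `|` X @^-1` [set -1]) =
    (P (X @^-1` [set 1%R]) + P (X @^-1` [set (-1)%R]))%E.
  apply: measureU => //; apply/seteqP; split => // w [/= -> /eqP].
  by rewrite -subr_eq0 opprK -[1 + 1]/(2%:R) pnatr_eq0.
rewrite PU X1 XN1 -EFinD (_ : 2^-1 + 2^-1 = 1); first by rewrite subrr.
by field.
Qed.

(** Split on the value of [X]: the two halves contribute half the Gaussian measure of [B] and of
    [- B], equal by symmetry, and the remaining part is null. *)
Lemma standard_normal_sign (X G : T -> R) : measurable_fun setT X ->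
  P (X @^-1` [set 1]) = (2^-1)%:E -> P (X @^-1` [set -1]) = (2^-1)%:E ->
  standard_normal P G -> indep_pair P X G ->
  standard_normal P (fun w => X w * G w).
Proof.
move=> mX X1 XN1 [mG nG] indXG; split; first exact: measurable_funM.
move=> B mB.
have m1 (x : R) : measurable (X @^-1` [set x]).
  by rewrite -[X in measurable X]setTI; exact: mX.
have mopp : measurable_fun setT (-%R : R -> R) by exact: oppr_measurable.
have mNB : measurable ((-%R : R -> R) @^-1` B).
  by rewrite -[X in measurable X]setTI; exact: mopp.
have mGpre C : measurable C -> measurable (G @^-1` C).
  by move=> mC; rewrite -[X in measurable X]setTI; exact: mG.
have mXG : measurable ((fun w => X w * G w) @^-1` B).
  by rewrite -[X in measurable X]setTI; apply: measurable_funM.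
have gamN : gam ((-%R : R -> R) @^-1` B) = gam B.
  transitivity (\int[gam]_x (\1_B (- x)%R)%:E)%E.
    by rewrite -[LHS](_ : \int[gam]_x (\1_((-%R : R -> R) @^-1` B) x)%:E = _)%E//
      integral_indic// setIT.
  rewrite (@ge0_integral_standard_normalN _ (fun x => (\1_B x)%:E)).
  - by rewrite integral_indic// setIT.
  - by apply/measurable_EFinP.
  - by move=> x; rewrite lee_fin.
set A := (fun w => X w * G w) @^-1` B.
pose A1 := X @^-1` [set 1] `&` G @^-1` B.
pose A2 := X @^-1` [set -1] `&` G @^-1` ((-%R : R -> R) @^-1` B).
pose A0 := A `&` ~` (X @^-1` [set 1] `|` X @^-1` [set -1]).
have AE : A = (A1 `|` A2) `|` A0.
  apply/seteqP; split => w; rewrite /A /A1 /A2 /A0/=.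
    move=> Bw; have [Xw|Xw] := pselect (X w = 1).
      by left; left; rewrite Xw mul1r in Bw *.
    have [Xw'|Xw'] := pselect (X w = -1).
      by left; right; rewrite Xw' mulN1r in Bw *.
    by right; split=> // -[].
  by move=> [[[Xw Gw]|[Xw Gw]]|[]//]; rewrite Xw ?mul1r ?mulN1r.
have mA1 : measurable A1 by apply: measurableI => //; exact: mGpre.
have mA2 : measurable A2 by apply: measurableI => //; exact: mGpre.
have mC : measurable (~` (X @^-1` [set 1] `|` X @^-1` [set -1])).
  by apply: measurableC; exact: measurableU.
have mA0 : measurable A0 by apply: measurableI.
have PA0 : P A0 = 0%E.
  apply: (subset_measure0 mA0 mC); first exact: subIsetr.
  exact: fair_sign_ae.
have PU0 : P ((A1 `|` A2) `|` A0) = P (A1 `|` A2).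
  by apply: measureU0 => //; exact: measurableU.
have PU : P (A1 `|` A2) = (P A1 + P A2)%E.
  apply: measureU => //; apply/seteqP; split => // w [[/= Xw _] [/eqP]]; rewrite Xw.
  by rewrite -subr_eq0 opprK -[1 + 1]/(2%:R) pnatr_eq0.
rewrite AE PU0 PU /A1 /A2 !indXG// X1 XN1 !nG// gamN -muleDl//; last first.
  by rewrite fin_num_measure.
by rewrite -EFinD (_ : 2^-1 + 2^-1 = 1) ?mul1e//; field.
Qed.

End random_signs.

Section model.
Context (R : realType) (alpha beta theta : R) (p n : nat).
Context (d : measure_display) (T : measurableType d) (P : probability T R).
Variables (l : 'I_n -> {RV P >-> R}) (mu : 'I_p -> {RV P >-> R}).
Variable Z : 'I_n -> 'I_p -> {RV P >-> R}.
Hypothesis arw : arw_model alpha beta theta l mu Z.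

Local Notation index := ('I_n + 'I_p + 'I_n * 'I_p)%type.
Let entry (k : index) : T -> R := arw_family l mu Z k.

Lemma arw_indep_family : indep_family P entry.
Proof.
split; first by move=> k; exact: measurable_funP.
move=> B mB; have := arw_indep arw finset.setT mB.
rewrite (_ : [set` finset.setT] = setT).
  by move=> ->; apply: eq_bigl => k; rewrite finset.in_setT.
by apply/seteqP; split => // k _ /=; rewrite finset.in_setT.
Qed.

Lemma arw_noise_normal i j : standard_normal P (Z i j).
Proof. by split; [exact: measurable_funP | move=> B mB; exact: (arw_noise arw)]. Qed.

(* Rows of [(l, Z)] are the blocks [inl i]; all of [mu] is the block [inr ord0]. *)
Definition row_or_mean (k : index) : 'I_n + 'I_1 :=
  match k with
  | inl (inl i) => inl i
  | inl (inr _) => inr ord0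
  | inr (i, _) => inl i
  end.

(** [U] is a function of the vector [mu] alone, hence independent of all rows of labels and
    noise. *)
Definition mean_measurable (U : T -> R) : Prop :=
  measurable_fun (setT : set (g_sigma_algebraType (block entry row_or_mean (inr ord0))))
    (U : g_sigma_algebraType (block entry row_or_mean (inr ord0)) -> R).

Lemma mean_measurable_mu j : mean_measurable (mu j).
Proof.
exact: (block_measurable_coord (Y := entry) (f := row_or_mean) (k := inl (inr j)) erefl).
Qed.

Definition noise_sum (S : {set 'I_p}) (i : 'I_n) (w : T) : R :=
  (Num.sqrt #|S|%:R)^-1 * \sum_(j in S) Z i j w.

(** Noise of row [i] seen after multiplying the row by its true label. In absolute value the row is
    unchanged, but its signal part no longer involves the label. *)
Definition signed_sum (S : {set 'I_p}) (i : 'I_n) (w : T) : R :=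
  l i w * noise_sum S i w.

Lemma noise_sum_normal (S : {set 'I_p}) (i : 'I_n) : (0 < #|S|)%N ->
  standard_normal P (noise_sum S i).
Proof.
move=> S0.
pose S' : {set index} := [set (inr (i, j) : index) | j in S]%SET.
have inj : injective (fun j : 'I_p => inr (i, j) : index) by move=> j k [].
have cardS : #|S'| = #|S| by rewrite card_imset.
rewrite (_ : noise_sum S i = fun w => (Num.sqrt #|S'|%:R)^-1 * \sum_(k in S') entry k w).
  apply: standard_normal_sum; first exact: arw_indep_family.
    by move=> k /finset.imsetP[j _ ->]; exact: arw_noise_normal.
  by rewrite cardS.
apply/funext => w; rewrite cardS /noise_sum big_imset//=.
by move=> ? ? _ _; exact: inj.
Qed.

Let measurable_row_sum (S : {set 'I_p}) (i : 'I_n) (b : index -> bool) :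
  (forall j, b (inr (i, j))) ->
  measurable_fun (setT : set (g_sigma_algebraType (block entry b true)))
    (noise_sum S i : g_sigma_algebraType (block entry b true) -> R).
Proof.
move=> bT; apply: measurable_funM => //.
rewrite (_ : (fun w => _) = fun w => \sum_j (if j \in S then Z i j w else 0)).
  apply: measurable_sum => j; case: (j \in S) => //.
  exact: (block_measurable_coord (Y := entry) (k := inr (i, j)) (bT j)).
by apply/funext => w; rewrite big_mkcond.
Qed.

Lemma signed_sum_normal (S : {set 'I_p}) (i : 'I_n) : (0 < #|S|)%N ->
  standard_normal P (signed_sum S i).
Proof.
move=> S0; apply: standard_normal_sign.
- exact: measurable_funP.
- exact: (arw_label_pos arw).
- exact: (arw_label_neg arw).
- exact: noise_sum_normal.
pose b (k : index) := if k is inr _ then true else false.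
pose V (c : bool) := if c then noise_sum S i else (l i : T -> R).
have indV : indep_family P V.
  apply: (indep_family_blocks (f := b) arw_indep_family) => -[].
    exact: measurable_row_sum.
  exact: (block_measurable_coord (Y := entry) (f := b) (k := inl (inl i)) erefl).
exact: (indep_family_pair indV (_ : false != true)).
Qed.

(** Row [i] of the family only reads [l i] and the noise [Z i j], and [U] only reads [mu], so each
    member stays in its own block of [row_or_mean]. *)
Lemma signed_sum_indep (S : {set 'I_p}) (U : T -> R) : mean_measurable U ->
  indep_family P (fun k : 'I_n + 'I_1 => if k is inl i then signed_sum S i else U).
Proof.
move=> mU; apply: (indep_family_blocks (f := row_or_mean) arw_indep_family) => -[i|i].
  apply: measurable_funM.
    exact: (block_measurable_coord (Y := entry) (f := row_or_mean) (k := inl (inl i)) erefl).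
  apply: measurable_funM => //.
  rewrite (_ : (fun w => _) = fun w => \sum_j (if j \in S then Z i j w else 0)).
    apply: measurable_sum => j; case: (j \in S) => //.
    exact: (block_measurable_coord (Y := entry) (f := row_or_mean) (k := inr (i, j)) erefl).
  by apply/funext => w; rewrite big_mkcond.
by rewrite (ord1 i).
Qed.

End model.

(** * Bounds on means *)

Section mean_bounds.
Context (R : realType) (d : measure_display) (T : measurableType d).
Variable P : probability T R.
Import HBNNSimple.

(** The integral of a nonnegative function is a supremum over simple functions below it, hence
    monotone for arbitrary functions. The Hamming error can thus be bounded without proving it
    measurable. *)
Lemma ge0_le_integral_nonmeas (f g : T -> \bar R) :
  (forall w, 0 <= f w)%E -> (forall w, f w <= g w)%E ->
  (\int[P]_w f w <= \int[P]_w g w)%E.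
Proof.
move=> f0 fg.
have g0 w : (0 <= g w)%E by exact: le_trans (f0 w) (fg w).
rewrite ge0_integralTE// ge0_integralTE//; apply: ereal_sup_le => _ [h hf <-].
exists h => // x; exact: le_trans (hf x) (fg x).
Qed.

(** Measurability and sign are bundled with the bound so that majorants can be assembled term by
    term. *)
Definition mean_le (f : T -> R) (b : R) : Prop :=
  [/\ measurable_fun setT f, forall w, 0 <= f w & (\int[P]_w (f w)%:E <= b%:E)%E].

Lemma mean_le_cst (c : R) : 0 <= c -> mean_le (fun=> c) c.
Proof.
move=> c0; split => //.
rewrite integral_cst// (_ : (c%:E * _)%E = c%:E)//.
by rewrite -[RHS]mule1; congr (_ * _)%E; exact: probability_setT.
Qed.

Lemma mean_leD (f g : T -> R) (a b : R) :
  mean_le f a -> mean_le g b -> mean_le (fun w => f w + g w) (a + b).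
Proof.
move=> [mf f0 fa] [mg g0 gb]; split.
- exact: measurable_funD.
- by move=> w; rewrite addr_ge0.
under eq_integral do rewrite EFinD.
rewrite ge0_integralD//; first by rewrite EFinD leeD.
- by move=> w _; rewrite lee_fin.
- exact/measurable_EFinP.
- by move=> w _; rewrite lee_fin.
- exact/measurable_EFinP.
Qed.

Lemma mean_leZ (f : T -> R) (c b : R) : 0 <= c ->
  mean_le f b -> mean_le (fun w => c * f w) (c * b).
Proof.
move=> c0 [mf f0 fb]; split.
- exact: measurable_funM.
- by move=> w; rewrite mulr_ge0.
under eq_integral do rewrite EFinM.
rewrite ge0_integralZl//; first by rewrite EFinM lee_wpmul2l// lee_fin.
- exact/measurable_EFinP.
- by move=> w _; rewrite lee_fin.
Qed.

Lemma mean_le_sum (I : finType) (f : I -> T -> R) (b : I -> R) (Q : pred I) :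
  (forall i, Q i -> mean_le (f i) (b i)) ->
  mean_le (fun w => \sum_(i | Q i) f i w) (\sum_(i | Q i) b i).
Proof.
move=> fb; elim: (index_enum I) => [|i s IH].
  by rewrite big_nil (_ : (fun w => _) = fun=> 0);
    [exact: mean_le_cst | apply/funext => w; rewrite big_nil].
rewrite big_cons (_ : (fun w => _) = fun w =>
    if Q i then f i w + \sum_(j <- s | Q j) f j w else \sum_(j <- s | Q j) f j w).
  by case: ifP => // Qi; apply: mean_leD => //; exact: fb.
by apply/funext => w; rewrite big_cons.
Qed.

Lemma mean_le_indic (A : set T) (b : R) : measurable A -> (P A <= b%:E)%E ->
  mean_le (\1_A) b.
Proof.
move=> mA Ab; split.
- exact: measurable_indic.
- by move=> w; rewrite indicE.
- by rewrite integral_indic// setIT.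
Qed.

Lemma mean_le_integral (f g : T -> R) (b : R) : mean_le g b ->
  (forall w, 0 <= f w) -> (forall w, f w <= g w) -> (\int[P]_w (f w)%:E <= b%:E)%E.
Proof.
move=> [_ _ gb] f0 fg; apply: le_trans gb.
by apply: ge0_le_integral_nonmeas => w; rewrite lee_fin.
Qed.

(** Together with [sum_lt1] this decodes a sum of indicators of exceptional events: where the sum is
    below 1, none of the events occurs. *)
Lemma indic_lt1 (A : set T) w : \1_A w < 1 :> R -> ~ A w.
Proof. by move=> + Aw; rewrite indicE mem_set// ltxx. Qed.

Lemma sum_lt1 (I : finType) (f : I -> R) (Q : pred I) i : (forall j, 0 <= f j) ->
  \sum_(j | Q j) f j < 1 -> Q i -> f i < 1.
Proof.
move=> f0 s1 Qi; apply: le_lt_trans s1.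
by rewrite (bigD1 i)//= lerDl sumr_ge0.
Qed.

End mean_bounds.

(** * Almost sure values of labels and means, and the size of the support *)

Section model_regularity.
Context (R : realType) (alpha beta theta : R) (p n : nat).
Context (d : measure_display) (T : measurableType d) (P : probability T R).
Variables (l : 'I_n -> {RV P >-> R}) (mu : 'I_p -> {RV P >-> R}).
Variable Z : 'I_n -> 'I_p -> {RV P >-> R}.
Hypothesis arw : arw_model alpha beta theta l mu Z.
Local Notation e := (eps beta p).
Local Notation ta := (tau alpha p).
Local Notation supp := (signal_support mu).

Lemma measurable_RV_preimage (X : {RV P >-> R}) (B : set R) :
  measurable B -> measurable (X @^-1` B).
Proof. by move=> mB; rewrite -[X in measurable X]setTI; exact: measurable_funP. Qed.

(** The number of labels and means off their two prescribed values. It vanishes only almost surely,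
    so it is carried along as an error term of mean zero. *)
Definition irregular (w : T) : R :=
  \sum_i \1_(~` (l i @^-1` [set 1] `|` l i @^-1` [set -1])) w +
  \sum_j \1_(~` (mu j @^-1` [set ta] `|` mu j @^-1` [set 0])) w.

Lemma irregular_mean_le : ta != 0 -> mean_le P irregular 0.
Proof.
move=> ta0.
rewrite (_ : 0 = \sum_(i < n) 0 + \sum_(j < p) 0 :> R); last by rewrite !big1_eq addr0.
apply: mean_leD; apply: mean_le_sum => k _; apply: mean_le_indic.
- by apply: measurableC; apply: measurableU; exact: measurable_RV_preimage.
- rewrite fair_sign_ae//; [exact: (arw_label_pos arw)|exact: (arw_label_neg arw)].
- by apply: measurableC; apply: measurableU; exact: measurable_RV_preimage.
rewrite probability_setC; last by apply: measurableU; exact: measurable_RV_preimage.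
have PU : P (mu k @^-1` [set ta] `|` mu k @^-1` [set 0]) =
    (P (mu k @^-1` [set ta]) + P (mu k @^-1` [set 0%R]))%E.
  apply: measureU; [exact: measurable_RV_preimage|exact: measurable_RV_preimage|].
  apply/seteqP; split => // w [/= -> ] /eqP; exact/negP.
rewrite PU (arw_mean_tau arw) (arw_mean_zero arw) -EFinD lee_fin.
by rewrite subr_le0; lra.
Qed.

Lemma regularP w : irregular w < 1 ->
  (forall i, l i w = 1 \/ l i w = -1) /\ (forall j, mu j w = ta \/ mu j w = 0).
Proof.
move=> irr1.
have i1 (f g : R) : 0 <= g -> f + g < 1 -> f < 1 by move=> ? ?; lra.
split=> [i|j].
  have : \sum_i \1_(~` (l i @^-1` [set 1] `|` l i @^-1` [set -1])) w < 1 :> R.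
    by apply: i1 irr1; apply: sumr_ge0 => j _; rewrite indicE.
  move/(sum_lt1 (i := i) (fun _ => ler0n _ _))/(_ isT)/indic_lt1.
  by move/contrapT.
have : \sum_j \1_(~` (mu j @^-1` [set ta] `|` mu j @^-1` [set 0])) w < 1 :> R.
  by move: irr1; rewrite /irregular addrC; apply: i1; apply: sumr_ge0 => i _; rewrite indicE.
move/(sum_lt1 (i := j) (fun _ => ler0n _ _))/(_ isT)/indic_lt1.
by move/contrapT.
Qed.

Lemma card_support w : #|supp w|%:R = \sum_j (mu j w != 0)%:R :> R.
Proof. by rewrite -sum1dep_card natr_sum [LHS]big_mkcond; apply: eq_bigr => j _; case: ifP. Qed.

Lemma measurable_card_support : measurable_fun setT (fun w => #|supp w|%:R : R).
Proof.
rewrite (_ : (fun w => _) = fun w => \sum_j (mu j w != 0)%:R); last first.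
  by apply/funext => w; exact: card_support.
apply: measurable_sum => j.
exact: (measurableT_comp (@measurable_nonzero R) (measurable_funP (mu j))).
Qed.

Lemma card_support_mean_le : mean_le P (fun w => #|supp w|%:R) (p%:R * e).
Proof.
split; [exact: measurable_card_support | by [] |].
under eq_integral do rewrite card_support.
rewrite (_ : p%:R = #|[set: 'I_p]%SET|%:R); last by rewrite finset.cardsT card_ord.
rewrite -(expectation_nonzero (P := P) (W := fun j => mu j : T -> R)).
- apply: ge0_le_integral_nonmeas => w; rewrite lee_fin ?sumr_ge0//.
  rewrite le_eqVlt; apply/orP; left; apply/eqP.
  by apply: eq_bigl => j; rewrite finset.in_setT.
- by move=> j.
- by move=> j _; exact: (arw_mean_zero arw).
Qed.

Lemma card_support_lower_tail (dl : R) : 0 <= e -> 0 <= dl ->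
  (P [set w | #|supp w|%:R <= (1 - dl) * (p%:R * e)]%R <=
   (expR (- (p%:R * e * dl ^+ 2 / 4)))%:E)%E.
Proof.
move=> e0 dl0.
pose S : {set 'I_n + 'I_p + 'I_n * 'I_p} := [set (inl (inr j)) | j in [set: 'I_p]]%SET.
have inj : injective (fun j : 'I_p => inl (inr j) : 'I_n + 'I_p + 'I_n * 'I_p) by move=> ? ? [].
have cardS : #|S| = p by rewrite card_imset// finset.cardsT card_ord.
have := @bernoulli_lower_tail R d T P _ _ S e dl (arw_indep_family arw).
rewrite cardS.
rewrite (_ : [set w | \sum_(k in S) _ <= _] = [set w | #|supp w|%:R <= (1 - dl) * (p%:R * e)]).
  apply => //; move=> _ /finset.imsetP[j _ ->]; exact: (arw_mean_zero arw).
apply/funext => w /=; rewrite card_support big_imset/=; last by move=> ? ? _ _; exact: inj.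
by rewrite (eq_bigl xpredT)// => j; rewrite finset.in_setT.
Qed.

Lemma arw_dataE w i j : arw_data l mu Z w i j = l i w * mu j w + Z i j w.
Proof. by rewrite !mxE big_ord1 !mxE. Qed.

End model_regularity.

(** * Simple aggregation *)

Section simple_aggregation.
Context (R : realType) (alpha beta theta : R) (p n : nat).
Context (d : measure_display) (T : measurableType d) (P : probability T R).
Variables (l : 'I_n -> {RV P >-> R}) (mu : 'I_p -> {RV P >-> R}).
Variable Z : 'I_n -> 'I_p -> {RV P >-> R}.
Hypothesis arw : arw_model alpha beta theta l mu Z.
Hypothesis n0 : (0 < n)%N.
Hypothesis p0 : (0 < p)%N.
Local Notation e := (eps beta p).
Local Notation ta := (tau alpha p).
Local Notation supp := (signal_support mu).
Local Notation X := (arw_data l mu Z).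

(** The signal present in every row sum once the support has more than half its expected size; noise
    below [K] cannot flip the label. *)
Let K : R := ta * (p%:R * e / 2).
Let r : R := Num.sqrt (2 * ln p%:R).

(* The noise in the score of column [j] when the true labels are used. *)
Definition oracle_noise (j : 'I_p) (w : T) : R :=
  (Num.sqrt n%:R)^-1 * \sum_i signed_sum l Z [set j]%SET i w.

(** Independence from [mu j] provides the factor [eps] in the probability of missing a signal. *)
Lemma oracle_noise_normal_indep (j : 'I_p) :
  standard_normal P (oracle_noise j) /\ indep_pair P (mu j) (oracle_noise j).
Proof.
have j1 : (0 < #|[set j]%SET|)%N by rewrite finset.cards1.
pose V (k : 'I_n + 'I_1) := if k is inl i then signed_sum l Z [set j]%SET i else (mu j : T -> R).
have indV : indep_family P V by apply: (signed_sum_indep arw); exact: mean_measurable_mu.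
split.
  pose S : {set 'I_n + 'I_1} := [set inl i | i in [set: 'I_n]]%SET.
  have inj : injective (fun i : 'I_n => inl i : 'I_n + 'I_1) by move=> ? ? [].
  have cardS : #|S| = n by rewrite card_imset// finset.cardsT card_ord.
  rewrite (_ : oracle_noise j = fun w => (Num.sqrt #|S|%:R)^-1 * \sum_(k in S) V k w).
    apply: standard_normal_sum => //; last by rewrite cardS.
    by move=> k /finset.imsetP[i _ ->]; exact: (signed_sum_normal arw).
  apply/funext => w; rewrite cardS /oracle_noise big_imset/=; last by move=> ? ? _ _; exact: inj.
  by congr (_ * _); apply: eq_bigl => i; rewrite finset.in_setT.
pose b (k : 'I_n + 'I_1) := if k is inl _ then true else false.
pose U (c : bool) := if c then oracle_noise j else (mu j : T -> R).
have indU : indep_family P U.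
  apply: (indep_family_blocks (f := b) indV) => -[].
    apply: measurable_funM => //; apply: measurable_sum => i.
    exact: (block_measurable_coord (Y := V) (f := b) (k := inl i) erefl).
  exact: (block_measurable_coord (Y := V) (f := b) (k := inr ord0) erefl).
exact: (indep_family_pair indU (_ : false != true)).
Qed.

Lemma sa_labelsE w : 0 < ta -> irregular alpha l mu w < 1 ->
  (forall i, `|\sum_j Z i j w| < K) -> (1 - 2^-1) * (p%:R * e) < #|supp w|%:R ->
  forall i, sa_labels (X w) i 0 = l i w.
Proof.
move=> ta0 /(regularP (mu := mu)) [lw muw] ZK sw i.
have -> : sa_labels (X w) i 0 = Num.sg (\sum_j X w i j).
  by rewrite !mxE summxE; congr Num.sg; apply: eq_bigr => j _; rewrite mxE.
have -> : \sum_j X w i j = l i w * (ta * #|supp w|%:R) + \sum_j Z i j w.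
  under eq_bigr do rewrite arw_dataE.
  rewrite big_split/= -mulr_sumr card_support [in RHS]mulr_sumr; congr (_ * _ + _).
  apply: eq_bigr => j _; case: (muw j) => ->; first by rewrite gt_eqF// mulr1.
  by rewrite eqxx mulr0.
have := ZK i; rewrite ltr_norml => /andP[Z1 Z2].
have Ks : K < ta * #|supp w|%:R.
  rewrite /K ltr_pM2l//; apply: le_lt_trans sw.
  by rewrite le_eqVlt; apply/orP; left; apply/eqP; field.
case: (lw i) => ->.
  by rewrite mul1r gtr0_sg//; lra.
by rewrite mulN1r ltr0_sg//; lra.
Qed.

Lemma sa_scoresE w j : (forall i, l i w = 1 \/ l i w = -1) ->
  (forall i, sa_labels (X w) i 0 = l i w) ->
  sa_scores (X w) j 0 = Num.sqrt n%:R * mu j w + oracle_noise j w.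
Proof.
move=> lw lE.
have l2 i : l i w * l i w = 1 by case: (lw i) => ->; rewrite ?mulr1// mulrNN mulr1.
have -> : sa_scores (X w) j 0 = (Num.sqrt n%:R)^-1 * \sum_i X w i j * l i w.
  by rewrite !mxE; congr (_ * _); apply: eq_bigr => i _; rewrite lE mxE.
have -> : \sum_i X w i j * l i w = n%:R * mu j w + \sum_i signed_sum l Z [set j]%SET i w.
  rewrite -[n in n%:R]card_ord mulr_natl -sumr_const -big_split/=; apply: eq_bigr => i _.
  rewrite arw_dataE /signed_sum /noise_sum finset.cards1 sqrtr1 invr1 mul1r finset.big_set1.
  by rewrite mulrDl mulrAC l2 mul1r [Z i j w * _]mulrC.
have sn : Num.sqrt n%:R != 0 :> R by rewrite gt_eqF// sqrtr_gt0 ltr0n.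
rewrite mulrDr; congr (_ + _).
have nE : n%:R = Num.sqrt n%:R * Num.sqrt n%:R :> R by rewrite -expr2 sqr_sqrtr.
by rewrite [X in _ * (X * _)]nE -mulrA mulKf.
Qed.

(** Where some label may be wrong, the error is bounded by [p]. Elsewhere it is counted column by
    column, as false positives or missed signals. *)
Lemma sa_hamming_bound : 0 < ta -> 0 <= e -> r <= Num.sqrt n%:R * ta ->
  (\int[P]_w #|symdiff (sa_support (X w)) (supp w)|%:R%:E <=
   (p%:R * (n%:R * (2 * expR (- (K ^+ 2 / p%:R / 2))) + expR (- (p%:R * e / 16)))
    + p%:R * (2 * expR (- (r ^+ 2 / 2)) +
              e * (2 * expR (- ((Num.sqrt n%:R * ta - r) ^+ 2 / 2)))))%:E)%E.
Proof.
move=> ta0 e0 rta.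
have r0 : 0 <= r by exact: sqrtr_ge0.
have K0 : 0 <= K by rewrite /K !mulr_ge0// ltW.
have sp : 0 < Num.sqrt p%:R :> R by rewrite sqrtr_gt0 ltr0n.
pose A (i : 'I_n) := [set w | K / Num.sqrt p%:R <= `|noise_sum Z [set: 'I_p]%SET i w|].
pose B := [set w | #|supp w|%:R <= (1 - 2^-1) * (p%:R * e)].
(* In [C j] the noise alone passes the threshold, which covers false positives; in [D j] it can pull
   a true signal below the threshold. *)
pose C (j : 'I_p) := [set w | r <= `|oracle_noise j w|].
pose D (j : 'I_p) := [set w | mu j w != 0] `&`
   [set w | Num.sqrt n%:R * ta - r <= `|oracle_noise j w|].
pose bad w := irregular alpha l mu w + (\sum_i \1_(A i) w + \1_B w) : R.
have mabs (V : T -> R) (a : R) : measurable_fun setT V -> measurable [set w | a <= `|V w|].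
  move=> mV; rewrite -[X in measurable X]setTI; apply: (measurable_fun_le measurableT) => //.
  exact: measurableT_comp.
have pT : (0 < #|[set: 'I_p]%SET|)%N by rewrite finset.cardsT card_ord.
have mB : mean_le P \1_B (expR (- (p%:R * e / 16))).
  apply: mean_le_indic.
    rewrite -[X in measurable X]setTI; apply: (measurable_fun_le measurableT) => //.
    exact: measurable_card_support.
  apply: le_trans (card_support_lower_tail arw e0 _) _ => //.
  by rewrite lee_fin ler_expR le_eqVlt; apply/orP; left; apply/eqP; field.
have mA : mean_le P (fun w => \sum_i \1_(A i) w) (n%:R * (2 * expR (- (K ^+ 2 / p%:R / 2)))).
  rewrite -[n in n%:R]card_ord mulr_natl -sumr_const.
  apply: mean_le_sum => i _; apply: mean_le_indic.
    by apply: mabs; exact: (noise_sum_normal arw i pT).1.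
  apply: le_trans (standard_normal_tail (noise_sum_normal arw i pT) _) _.
    by rewrite divr_ge0// ltW.
  by rewrite exprMn exprVn sqr_sqrtr.
have mbad : mean_le P bad
    (n%:R * (2 * expR (- (K ^+ 2 / p%:R / 2))) + expR (- (p%:R * e / 16))).
  rewrite -[X in mean_le P bad X]add0r; apply: mean_leD; last exact: mean_leD.
  by apply: (irregular_mean_le arw); rewrite gt_eqF.
have mC j : mean_le P \1_(C j) (2 * expR (- (r ^+ 2 / 2))).
  have [nY _] := oracle_noise_normal_indep j.
  by apply: mean_le_indic; [apply: mabs; exact: nY.1 | exact: standard_normal_tail].
have mD j : mean_le P \1_(D j) (e * (2 * expR (- ((Num.sqrt n%:R * ta - r) ^+ 2 / 2)))).
  have [nY indY] := oracle_noise_normal_indep j.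
  have mNZ : measurable (~` [set (0 : R)]) by apply: measurableC; exact: measurable_set1.
  have DE : D j = mu j @^-1` (~` [set 0]) `&`
      oracle_noise j @^-1` [set x | Num.sqrt n%:R * ta - r <= `|x|].
    by rewrite /D; congr (_ `&` _); apply/seteqP; split => w /= /eqP.
  have mge : measurable [set x : R | Num.sqrt n%:R * ta - r <= `|x|].
    by rewrite -[X in measurable X]setTI; apply: (measurable_fun_le measurableT).
  apply: mean_le_indic.
    rewrite DE; apply: measurableI; first exact: measurable_RV_preimage.
    by rewrite -[X in measurable X]setTI; exact: nY.1.
  rewrite DE indY// EFinM.
  have -> : P (mu j @^-1` (~` [set 0])) = e%:E.
    rewrite -(probability_nonzero (measurable_funP (mu j)) (arw_mean_zero arw j)).
    by congr (P _); apply/seteqP; split => w /= /eqP.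
  apply: lee_wpmul2l; first by rewrite lee_fin.
  by apply: standard_normal_tail => //; rewrite subr_ge0.
apply: (@mean_le_integral _ _ _ P _ (fun w => p%:R * bad w +
  \sum_j (\1_(C j) w + \1_(D j) w))).
- apply: mean_leD; first exact: mean_leZ.
  rewrite -{1}[p in p%:R * _]card_ord mulr_natl -sumr_const.
  by apply: mean_le_sum => j _; apply: mean_leD.
- by move=> w.
move=> w.
have CD0 : 0 <= \sum_j (\1_(C j) w + \1_(D j) w) :> R.
  by apply: sumr_ge0 => j _; rewrite addr_ge0// indicE.
have [bad1|bad1] := leP 1 (bad w).
  rewrite -[leLHS]addr0 lerD// -[leLHS]mulr1 ler_pM// ler_nat.
  by rewrite -[leqRHS]card_ord max_card.
have irr0 : 0 <= irregular alpha l mu w by rewrite addr_ge0// sumr_ge0// => k _; rewrite indicE.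
have A0 : 0 <= \sum_i \1_(A i) w :> R by rewrite sumr_ge0// => k _; rewrite indicE.
have B0 : 0 <= \1_B w :> R by rewrite indicE.
have irr1 : irregular alpha l mu w < 1.
  by move: bad1; rewrite /bad; lra.
have A1 : \sum_i \1_(A i) w < 1 :> R.
  by move: bad1; rewrite /bad; lra.
have B1 : \1_B w < 1 :> R.
  by move: bad1; rewrite /bad; lra.
have [lw muw] := regularP irr1.
have lE : forall i, sa_labels (X w) i 0 = l i w.
  apply: sa_labelsE => // [i|].
    have /indic_lt1 := sum_lt1 (i := i) (fun _ => ler0n _ _) A1 isT.
    move/negP; rewrite -ltNge /noise_sum finset.cardsT card_ord normrM ger0_norm ?invr_ge0 ?ltW//.
    rewrite mulrC ltr_pM2r ?invr_gt0//.
    by rewrite (eq_bigl xpredT)// => j; rewrite finset.in_setT.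
  by move/indic_lt1: B1 => /negP; rewrite -ltNge.
have bad0 : 0 <= p%:R * bad w by apply: mulr_ge0 => //; apply: addr_ge0 => //; exact: addr_ge0.
rewrite -[leLHS]add0r lerD// -sum1_card natr_sum big_mkcond/=.
apply: ler_sum => j _; case: ifPn => [|_]; last by rewrite addr_ge0// indicE.
have scE := sa_scoresE j lw lE.
rewrite /symdiff finset.in_setU !finset.in_setD !finset.inE -/r scE => /orP[/andP[]|/andP[]].
  rewrite negbK => /eqP mu0; rewrite mu0 mulr0 add0r => rY.
  rewrite [X in X + _](_ : _ = 1); first by rewrite lerDl indicE.
  by rewrite indicE mem_set.
rewrite -ltNge => rY muj.
rewrite [X in _ + X](_ : _ = 1); first by rewrite lerDr indicE.
rewrite indicE mem_set//; split => //=.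
have muE : mu j w = ta by case: (muw j) => // muj0; rewrite muj0 eqxx in muj.
move: rY; rewrite muE => rY.
have := ler_normB (Num.sqrt n%:R * ta + oracle_noise j w) (oracle_noise j w).
rewrite addrK ger0_norm; last by rewrite mulr_ge0 ?sqrtr_ge0// ltW.
by lra.
Qed.

End simple_aggregation.

(** * Sparse aggregation *)

Lemma subset_of_card (I : finType) (A : {set I}) (k : nat) : (k <= #|A|)%N ->
  exists2 B : {set I}, (B \subset A)%SET & #|B| = k.
Proof.
move=> kA; have : (0 < #|[set B : {set I} | (B \subset A) && (#|B| == k)]%SET|)%N.
  by rewrite cards_draws bin_gt0.
by move=> /card_gt0P[B]; rewrite finset.inE => /andP[BA /eqP]; exists B.
Qed.

(** Supplies the competitor of the maximizer: the true support need not have the prescribed size, so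
    it is shrunk or padded. *)
Lemma large_overlap (I : finType) (M : {set I}) (k : nat) : (k <= #|I|)%N ->
  exists2 S : {set I}, #|S| = k & (minn k #|M| <= #|(S :&: M)%SET|)%N.
Proof.
move=> kI; have [kM|Mk] := leqP k #|M|.
  have [B BM Bk] := subset_of_card kM.
  by exists B => //; rewrite (finset.setIidPl BM) Bk.
have kMC : (k - #|M| <= #|(~: M)%SET|)%N.
  by have := finset.cardsC M; lia.
have [B BM Bk] := subset_of_card kMC.
exists (M :|: B)%SET; last by rewrite (finset.setIidPr (finset.subsetUl M B)); lia.
rewrite finset.cardsU (_ : (M :&: B)%SET = finset.set0) ?finset.cards0 ?Bk; first by lia.
by apply/eqP; rewrite finset.setI_eq0 disjoint_sym finset.disjoints_subset.
Qed.

Lemma card_symdiff (I : finType) (A B : {set I}) :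
  (#|symdiff A B| + 2 * #|(A :&: B)%SET| = #|A| + #|B|)%N.
Proof.
rewrite /symdiff finset.cardsU (_ : (_ :&: _)%SET = finset.set0) ?finset.cards0; last first.
  by apply/finset.setP => x; rewrite !finset.inE; case: (x \in A); case: (x \in B).
have := finset.cardsID B A; have := finset.cardsID A B; rewrite (finset.setIC B A).
lia.
Qed.

Section sparse_aggregation.
Context (R : realType) (alpha beta theta : R) (p n : nat).
Context (d : measure_display) (T : measurableType d) (P : probability T R).
Variables (l : 'I_n -> {RV P >-> R}) (mu : 'I_p -> {RV P >-> R}).
Variable Z : 'I_n -> 'I_p -> {RV P >-> R}.
Hypothesis arw : arw_model alpha beta theta l mu Z.
Hypothesis n0 : (0 < n)%N.
Local Notation e := (eps beta p).
Local Notation ta := (tau alpha p).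
Local Notation supp := (signal_support mu).
Local Notation X := (arw_data l mu Z).
Variable N : nat.
Hypothesis N0 : (0 < N)%N.
Hypothesis Np : (N <= p)%N.

(** The indicator of [supp = M], written as a product over the coordinates of [mu] so that it is
    visibly a function of [mu]. *)
Definition supp_indic (M : {set 'I_p}) (w : T) : R :=
  \prod_j (if j \in M then (mu j w != 0)%:R else 1 - (mu j w != 0)%:R).

Lemma supp_indicE M : supp_indic M = \1_[set w | supp w = M].
Proof.
apply/funext => w; rewrite indicE.
have [wM|wM] := pselect (supp w = M).
  rewrite mem_set//= /supp_indic big1// => j _.
  by rewrite -wM finset.inE; case: (mu j w != 0) => //=; rewrite subr0.
rewrite memNset//=; apply/eqP; rewrite prodf_seq_eq0; apply/hasP.
have : ~~ [forall j, (mu j w != 0) == (j \in M)].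
  by apply/negP => /forallP h; apply: wM; apply/finset.setP => j; rewrite finset.inE (eqP (h j)).
rewrite negb_forall => /existsP[j jM]; exists j; first by rewrite mem_index_enum.
by move: jM => /=; case: (mu j w != 0); case: (j \in M) => //= _; rewrite ?subrr.
Qed.

Lemma mean_measurable_supp_indic M : mean_measurable l mu Z (supp_indic M).
Proof.
apply: measurable_prod => j _.
have mb : measurable_fun setT (fun x : R => if j \in M then (x != 0)%:R else 1 - (x != 0)%:R : R).
  case: (j \in M); first exact: measurable_nonzero.
  by apply: measurable_funB => //; exact: measurable_nonzero.
have mj : mean_measurable l mu Z (mu j) by exact: mean_measurable_mu.
rewrite /mean_measurable in mj; exact: (measurableT_comp mb mj).
Qed.

Lemma measurable_supp_eq M : measurable [set w | supp w = M].
Proof.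
have -> : [set w | supp w = M] = (supp_indic M : T -> R) @^-1` [set 1].
  rewrite supp_indicE; apply/seteqP; split => w /=; rewrite indicE.
    by move=> wM; rewrite mem_set.
  by apply: contraPP => wM; rewrite memNset// => /eqP; rewrite eq_sym oner_eq0.
have mU : measurable_fun setT (supp_indic M).
  exact: ((signed_sum_indep arw finset.set0 (mean_measurable_supp_indic M)).1 (inr ord0)).
by rewrite -[X in measurable X]setTI; exact: mU.
Qed.

Definition signal_level (S M : {set 'I_p}) : R :=
  (Num.sqrt N%:R)^-1 * (ta * #|(S :&: M)%SET|%:R).

Lemma sparse_sa_objectiveE w (S : {set 'I_p}) : #|S| = N ->
  (forall i, l i w = 1 \/ l i w = -1) -> (forall j, mu j w = ta \/ mu j w = 0) ->
  ta != 0 ->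
  sparse_sa_objective N (X w) S =
  \sum_i `|signal_level S (supp w) + signed_sum l Z S i w|.
Proof.
move=> SN lw muw ta0; rewrite /sparse_sa_objective /norm1 mulr_sumr; apply: eq_bigr => i _.
have -> : (\sum_(j in S) col j (X w)) i 0 =
    l i w * (ta * #|(S :&: supp w)%SET|%:R) + \sum_(j in S) Z i j w.
  rewrite summxE; under eq_bigr do rewrite mxE arw_dataE.
  rewrite big_split/= -mulr_sumr; congr (_ * _ + _).
  rewrite -sum1_card natr_sum mulr_sumr [LHS]big_mkcond [RHS]big_mkcond/=.
  apply: eq_bigr => j _; rewrite !finset.inE; case: (j \in S) => //=.
  by case: (muw j) => ->; [rewrite ta0 mulr1 | rewrite eqxx].
rewrite -[X in X * _](@ger0_norm R) ?invr_ge0// -normrM mulrDr.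
rewrite /signed_sum /signal_level /noise_sum SN.
case: (lw i) => ->; first by rewrite !mul1r.
rewrite !mulN1r mulrN -normrN opprD opprK; congr (`|_ + _|).
Qed.

(** Freezing the support at [M] makes the signal level a number. [c = false] is an upper deviation
    of the objective, [c = true] a lower one. *)
Definition deviation (t : R) (S : {set 'I_p}) (c : bool) (M : {set 'I_p}) : set T :=
  [set w | supp w = M] `&`
  [set w | n%:R * t <= (-1) ^+ c * (\sum_i `|signal_level S M + signed_sum l Z S i w| -
                               n%:R * folded_mean (signal_level S M))].

(** Total probability: the Chernoff bound carries the factor [P (supp = M)], and these add up to 1,
    so summing over all [M] costs nothing. *)
Lemma deviation_mean_le (t : R) (S : {set 'I_p}) (c : bool) : 0 <= t -> #|S| = N ->
  mean_le P (fun w => \sum_M \1_(deviation t S c M) w) (expR (- (n%:R * t ^+ 2 / 4))).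
Proof.
move=> t0 SN.
have S0 : (0 < #|S|)%N by rewrite SN.
set x := expR _.
have mE M := measurable_supp_eq M.
have mD M : measurable (deviation t S c M).
  apply: measurableI => //; rewrite -[X in measurable X]setTI.
  apply: (measurable_fun_le measurableT) => //; apply: measurable_funM => //.
  apply: measurable_funB => //; apply: measurable_sum => i.
  apply: measurableT_comp => //; apply: measurable_funD => //.
  exact: (signed_sum_normal arw i S0).1.
pose q M : R := fine (P [set w | supp w = M]).
have qE M : P [set w | supp w = M] = (q M)%:E by rewrite /q fineK// fin_num_measure.
have PD M : (P (deviation t S c M) <= (q M * x)%:E)%E.
  have indM : indep_family P (fun k : 'I_n + 'I_1 =>
      if k is inl i then signed_sum l Z S i else \1_[set w | supp w = M]).
    by rewrite -supp_indicE; exact: (signed_sum_indep arw S (mean_measurable_supp_indic M)).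
  have := folded_chernoff (signal_level S M) (mE M) indM
    (fun i => signed_sum_normal arw i S0) t0 (sqrr_sign _ c).
  by rewrite card_ord EFinM -qE.
have sumq : \sum_M q M = 1.
  apply: EFin_inj; rewrite -sumEFin.
  under eq_bigr do rewrite -qE.
  transitivity (\int[P]_w (\sum_M (\1_[set w | supp w = M] w)%:E))%E.
    rewrite ge0_integral_sum//; last first.
      by move=> M; apply/measurable_EFinP; exact: measurable_indic.
    by apply: eq_bigr => M _; rewrite integral_indic// setIT.
  transitivity (\int[P]_w (cst 1%E w))%E; last first.
    by rewrite integral_cst// mul1e; exact: probability_setT.
  apply: eq_integral => w _; rewrite (bigD1 (supp w))//= big1 ?adde0.
    by rewrite indicE mem_set.
  by move=> M Mw; rewrite indicE memNset//= => wM; rewrite wM eqxx in Mw.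
rewrite -[x]mul1r -sumq mulr_suml.
by apply: mean_le_sum => M _; exact: mean_le_indic.
Qed.

Variable Shat : T -> {set 'I_p}.
Hypothesis Shat_max : forall w, is_sparse_sa_support N (X w) (Shat w).
Hypothesis Shat_meas : forall S, measurable [set w | Shat w = S].

Variables t dl : R.
Local Notation v := ((Num.sqrt N%:R)^-1 * (ta * (p%:R * e))).
Hypothesis t0 : 0 < t.
Hypothesis dl01 : 0 < dl < 2^-1.
Hypothesis ta0 : 0 < ta.
Hypothesis e0 : 0 <= e.
Hypothesis Npe : p%:R * e <= N%:R.
(** The right-hand side is the gain guaranteed by [folded_mean_increase] between the levels
    [(1 - 2 dl) v] and [(1 - dl) v]; the left-hand side allows one deviation [t] for each of the two
    sets compared. *)
Hypothesis separated : 2 * t <=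
  2 * normal_pdf 0 1 1 * Num.min ((1 - 2 * dl) * v) 1 * (dl * v).

(** A smaller overlap would put [Shat] below level [(1 - 2 dl) v], while a competitor reaches
    [(1 - dl) v]. The gap in means exceeds both deviations, contradicting maximality. Two margins
    are needed because the support itself may fall short of [p eps] by a fraction [dl]. *)
Lemma overlap_lower_bound w : irregular alpha l mu w < 1 ->
  (forall (S : {set 'I_p}) c M, #|S| = N -> ~ deviation t S c M w) ->
  (1 - dl) * (p%:R * e) < #|supp w|%:R ->
  (1 - 2 * dl) * (p%:R * e) <= #|(Shat w :&: supp w)%SET|%:R.
Proof.
move=> /regularP[lw muw] dev sw; rewrite leNgt; apply/negP => mw.
have /andP[dl0 dl1] := dl01.
have [ShN Shmax] := Shat_max w.
have Np' : (N <= #|'I_p|)%N by rewrite card_ord.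
have [S0 S0N S0w] := large_overlap (supp w) Np'.
have taN0 : ta != 0 by rewrite gt_eqF.
have pe0 : 0 <= p%:R * e by rewrite mulr_ge0.
have sN : 0 < (Num.sqrt N%:R)^-1 :> R by rewrite invr_gt0 sqrtr_gt0 ltr0n.
have := Shmax S0 S0N; rewrite !sparse_sa_objectiveE// => objle.
have devle (S : {set 'I_p}) (c : bool) : #|S| = N ->
    (-1) ^+ c * (\sum_i `|signal_level S (supp w) + signed_sum l Z S i w| -
    n%:R * folded_mean (signal_level S (supp w))) < n%:R * t.
  by move=> SN; rewrite ltNge; apply/negP => h; exact: (dev S c (supp w) SN (conj erefl h)).
have := devle (Shat w) false ShN; rewrite expr0 mul1r => d1.
have := devle S0 true S0N; rewrite expr1 mulN1r => d2.
have v0 : 0 <= v by rewrite mulr_ge0// ?mulr_ge0// ltW.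
have u1 : signal_level (Shat w) (supp w) <= (1 - 2 * dl) * v.
  rewrite /signal_level [leRHS]mulrCA ler_pM2l// [leRHS]mulrCA ler_pM2l//; exact: ltW.
have u2 : (1 - dl) * v <= signal_level S0 (supp w).
  rewrite /signal_level [leLHS]mulrCA ler_pM2l// [leLHS]mulrCA ler_pM2l//.
  have m0 : (1 - dl) * (p%:R * e) <= (minn N #|supp w|)%:R.
    have /orP[/eqP ->|/eqP ->] : (minn N #|supp w| == N) || (minn N #|supp w| == #|supp w|).
    - by rewrite /minn; case: ifP => _; rewrite eqxx ?orbT.
    - by apply: le_trans Npe; rewrite ler_piMl//; lra.
    - exact: ltW.
  by apply: le_trans m0 _; rewrite ler_nat.
have b0 : 0 <= (1 - 2 * dl) * v.
  by rewrite mulr_ge0//; lra.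
have ab : (1 - 2 * dl) * v <= (1 - dl) * v.
  by rewrite ler_wpM2r//; lra.
have h1 := folded_mean_increase b0 ab.
have u0 : 0 <= signal_level (Shat w) (supp w).
  by rewrite /signal_level !mulr_ge0 ?invr_ge0// ltW.
have h2 := folded_mean_le u0 u1.
have h3 := folded_mean_le (le_trans b0 ab) u2.
have hE : (1 - dl) * v - (1 - 2 * dl) * v = dl * v by ring.
rewrite hE in h1.
have n1 : 0 < n%:R :> R by rewrite ltr0n.
have : n%:R * (folded_mean (signal_level S0 (supp w)) -
    folded_mean (signal_level (Shat w) (supp w))) < n%:R * (2 * t).
  by lra.
rewrite ltr_pM2l// => h4.
by have := le_trans separated h1; lra.
Qed.

Lemma sparse_sa_hamming_bound :
  (\int[P]_w #|symdiff (Shat w) (supp w)|%:R%:E <=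
   (N%:R + p%:R * e - 2 * ((1 - 2 * dl) * (p%:R * e)) + 2 * (p%:R * e) *
     (expR (- (p%:R * e * dl ^+ 2 / 4)) +
      'C(p, N)%:R * (2 * expR (- (n%:R * t ^+ 2 / 4)))))%:E)%E.
Proof.
have /andP[dl0 dl1] := dl01.
pose B := [set w | #|supp w|%:R <= (1 - dl) * (p%:R * e)].
pose dev w : R :=
  \sum_(S : {set 'I_p} | #|S| == N) \sum_(c : bool) \sum_M \1_(deviation t S c M) w.
pose bad w : R := irregular alpha l mu w + (\1_B w + dev w).
have pe0 : 0 <= p%:R * e by rewrite mulr_ge0.
have mB : mean_le P \1_B (expR (- (p%:R * e * dl ^+ 2 / 4))).
  apply: mean_le_indic.
    rewrite -[X in measurable X]setTI; apply: (measurable_fun_le measurableT) => //.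
    exact: measurable_card_support.
  by apply: (card_support_lower_tail arw) => //; lra.
have mdev : mean_le P dev ('C(p, N)%:R * (2 * expR (- (n%:R * t ^+ 2 / 4)))).
  have -> : 'C(p, N)%:R * (2 * expR (- (n%:R * t ^+ 2 / 4))) =
      \sum_(S : {set 'I_p} | #|S| == N) \sum_(c : bool) expR (- (n%:R * t ^+ 2 / 4)).
    rewrite !sumr_const card_bool -[p in 'C(p, N)]card_ord -card_draws.
    rewrite !mulr_natl; congr (_ *+ _).
    by apply: eq_card => S; rewrite finset.inE.
  apply: mean_le_sum => S /eqP SN; apply: mean_le_sum => c _.
  by apply: deviation_mean_le => //; exact: ltW.
have mbad : mean_le P bad (expR (- (p%:R * e * dl ^+ 2 / 4)) +
      'C(p, N)%:R * (2 * expR (- (n%:R * t ^+ 2 / 4)))).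
  rewrite -[X in mean_le P bad X]add0r; apply: mean_leD; last exact: mean_leD.
  by apply: (irregular_mean_le arw); rewrite gt_eqF.
pose f w : R := #|symdiff (Shat w) (supp w)|%:R.
have mf : measurable_fun setT f.
  (* Both sets take finitely many values, so the error is a finite combination of indicators. *)
  rewrite (_ : f = fun w => \sum_S \sum_M (#|symdiff S M|%:R *
      (\1_[set w | Shat w = S] w * \1_[set w | supp w = M] w))).
    apply: measurable_sum => S; apply: measurable_sum => M; apply: measurable_funM => //.
    apply: measurable_funM; apply: measurable_indic; [exact: Shat_meas | exact: measurable_supp_eq].
  apply/funext => w; rewrite (bigD1 (Shat w))//= [X in _ + X]big1 ?addr0; last first.
    move=> S Sw; apply: big1 => M _.
    rewrite !indicE [w \in [set _ | _ = S]]memNset ?mul0r ?mulr0//=.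
    by move=> wS; rewrite wS eqxx in Sw.
  rewrite (bigD1 (supp w))//= big1 ?addr0; last first.
    move=> M Mw; rewrite !indicE [w \in [set _ | _ = M]]memNset ?mulr0//=.
    by move=> wM; rewrite wM eqxx in Mw.
  by rewrite !indicE !mem_set// !mulr1.
set y := _ + _ * _ in mbad *.
(* The lower bound on twice the overlap is added to the error, keeping both integrands nonnegative,
   and is subtracted only after integration. *)
pose c := 2 * ((1 - 2 * dl) * (p%:R * e)).
have c0 : 0 <= c by rewrite !mulr_ge0//; lra.
have : (\int[P]_w (f w + c)%:E <= (N%:R + (p%:R * e) + 2 * (p%:R * e) * y)%:E)%E.
  apply: (@mean_le_integral _ _ _ P _ (fun w => N%:R + #|supp w|%:R + 2 * (p%:R * e) * bad w)).
  - apply: mean_leD; last by apply: mean_leZ => //; rewrite mulr_ge0.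
    by apply: mean_leD; [exact: mean_le_cst | exact: (card_support_mean_le arw)].
  - by move=> w; rewrite addr_ge0.
  move=> w.
  have fE : f w + 2 * #|(Shat w :&: supp w)%SET|%:R = N%:R + #|supp w|%:R.
    by rewrite /f -natrM -!natrD card_symdiff (Shat_max w).1.
  have irr0 : 0 <= irregular alpha l mu w by rewrite addr_ge0// sumr_ge0// => k _; rewrite indicE.
  have B0 : 0 <= \1_B w :> R by rewrite indicE.
  have s0 S : 0 <= \sum_(c : bool) \sum_M \1_(deviation t S c M) w :> R.
    by apply: sumr_ge0 => ? _; apply: sumr_ge0 => ? _; rewrite indicE.
  have dev0 : 0 <= dev w by apply: sumr_ge0.
  have bad0 : 0 <= bad w by apply: addr_ge0 => //; exact: addr_ge0.
  have ov0 : 0 <= #|(Shat w :&: supp w)%SET|%:R :> R by [].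
  have [bad1|bad1] := leP 1 (bad w).
    (* The error never exceeds [N + |supp|], so on the exceptional set only [c <= 2 p eps] has to be
       paid for. *)
    have : 2 * (p%:R * e) <= 2 * (p%:R * e) * bad w by rewrite ler_peMr// mulr_ge0.
    have : c <= 2 * (p%:R * e) by rewrite /c ler_wpM2l// ler_piMl//; lra.
    by lra.
  have irr1 : irregular alpha l mu w < 1.
    by move: bad1; rewrite /bad; lra.
  have B1 : \1_B w < 1 :> R.
    by move: bad1; rewrite /bad; lra.
  have dev1 : dev w < 1.
    by move: bad1; rewrite /bad; lra.
  have ov : (1 - 2 * dl) * (p%:R * e) <= #|(Shat w :&: supp w)%SET|%:R.
    apply: overlap_lower_bound => //; last by move/indic_lt1: B1 => /negP; rewrite -ltNge.
    move=> S b M /eqP SN; apply: indic_lt1.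
    have h1 := sum_lt1 s0 dev1 SN.
    have h2 := sum_lt1 (i := b) (fun _ => sumr_ge0 _ (fun _ _ => ler0n _ _)) h1 isT.
    exact: (sum_lt1 (i := M) (fun _ => ler0n _ _) h2 isT).
  have : 0 <= 2 * (p%:R * e) * bad w by rewrite !mulr_ge0.
  by rewrite /c; lra.
under eq_integral do rewrite EFinD.
rewrite ge0_integralD//; last 2 first.
- by move=> w _; rewrite lee_fin.
- exact/measurable_EFinP.
rewrite integral_cst// (_ : (c%:E * _ = c%:E)%E); last first.
  by rewrite -[RHS]mule1; congr (_ * _)%E; exact: probability_setT.
rewrite -leeBrDr// -EFinB => h; apply: le_trans h _; rewrite lee_fin /c; lra.
Qed.

End sparse_aggregation.

(** * Asymptotics *)

Section asymptotics.
Context (R : realType).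

Lemma powR_nat_ge (c A : R) : 0 < c -> \forall p \near \oo, A <= p%:R `^ c.
Proof.
move=> c0.
pose B := Num.max A 1.
have B0 : 0 < B by rewrite lt_max ltr01 orbT.
near=> p.
have pB : B `^ c^-1 <= p%:R by near: p; exact: nbhs_infty_ger.
apply: (@le_trans _ _ B); first by rewrite le_max lexx.
have -> : B = (B `^ c^-1) `^ c by rewrite -powRrM mulVf ?gt_eqF// powRr1// ltW.
by apply: ge0_ler_powR; rewrite ?nnegrE ?powR_ge0// ltW.
Unshelve. all: by end_near. Qed.

Lemma powR_natN_le (c ep : R) : 0 < c -> 0 < ep ->
  \forall p \near \oo, p%:R `^ (- c) <= ep.
Proof.
move=> c0 ep0; near=> p.
have h : ep^-1 <= p%:R `^ c by near: p; exact: powR_nat_ge.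
rewrite powRN -[leRHS]invrK lef_pV2// posrE ?invr_gt0//.
by apply: lt_le_trans h; rewrite invr_gt0.
Unshelve. all: by end_near. Qed.

(** Half of the exponent dominates the logarithm, through [ln q <= q] at [q = p ^ (c / 2)]; the
    other half absorbs the constant. *)
Lemma ln_nat_le_powR (c A : R) : 0 < c ->
  \forall p \near \oo, A * ln p%:R <= p%:R `^ c.
Proof.
move=> c0; pose c2 := c / 2.
have c20 : 0 < c2 by rewrite divr_gt0.
near=> p.
have p0 : 0 < p%:R :> R by rewrite ltr0n; near: p; exact: nbhs_infty_gt.
have q0 : 0 < p%:R `^ c2 by rewrite powR_gt0.
have h : `|A| / c2 <= p%:R `^ c2 by near: p; exact: powR_nat_ge.
have lnp : 0 <= ln p%:R :> R.
  by rewrite ln_ge0// ler1n -(ltr0n R).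
have lnq : c2 * ln p%:R <= p%:R `^ c2.
  by rewrite -ln_powR; exact/ltW/ln_sublinear.
have -> : p%:R `^ c = p%:R `^ c2 * p%:R `^ c2.
  rewrite -powRD; last by rewrite (gt_eqF p0) implybT.
  by congr (_ `^ _); rewrite /c2; field.
apply: (@le_trans _ _ (`|A| * ln p%:R)); first by rewrite ler_wpM2r// ler_norm.
have -> : `|A| * ln p%:R = (`|A| / c2) * (c2 * ln p%:R).
  by rewrite mulrA divfK// gt_eqF.
by apply: ler_pM; rewrite ?mulr_ge0 ?invr_ge0// ltW.
Unshelve. all: by end_near. Qed.

Lemma expRN_ln (x : R) : 0 < x -> expR (- ln x) = x^-1.
Proof. by move=> x0; rewrite expRN lnK// posrE. Qed.

(** Eventually [b p ^ c >= (a + 1) ln p], so the product is at most [p ^ (-1)]. *)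
Lemma powR_expR_le (a b c ep : R) : 0 < b -> 0 < c -> 0 < ep ->
  \forall p \near \oo, p%:R `^ a * expR (- (b * p%:R `^ c)) <= ep.
Proof.
move=> b0 c0 ep0; near=> p.
have p0 : 0 < p%:R :> R by rewrite ltr0n; near: p; exact: nbhs_infty_gt.
have h : (b^-1 * (a + 1)) * ln p%:R <= p%:R `^ c by near: p; exact: ln_nat_le_powR.
have pe : p%:R `^ (- 1) <= ep by near: p; exact: powR_natN_le.
apply: le_trans pe; rewrite /powR gt_eqF// -expRD ler_expR.
have : b * (b^-1 * (a + 1) * ln p%:R) <= b * p%:R `^ c by rewrite ler_wpM2l// ltW.
rewrite !mulrA divff ?mul1r ?gt_eqF//.
by rewrite /powR gt_eqF//; lra.
Unshelve. all: by end_near. Qed.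

Lemma cvg0_ereal_le (u : nat -> \bar R) :
  (forall ep : R, 0 < ep -> \forall p \near \oo, (0 <= u p <= ep%:E)%E) ->
  u p @[p --> \oo] --> 0%E.
Proof.
move=> h; apply/fine_cvgP; split.
  near=> p; have /andP[u0 u1] : (0 <= u p <= 1%:E)%E by near: p; exact: h.
  by rewrite ge0_fin_numE//; apply: le_lt_trans u1 _; rewrite ltry.
apply/cvgr0Pnorm_le => ep ep0; near=> p.
have /andP[u0 u1] : (0 <= u p <= ep%:E)%E by near: p; exact: h.
have ufin : u p \is a fin_num.
  by rewrite ge0_fin_numE//; apply: le_lt_trans u1 _; rewrite ltry.
by rewrite /= ger0_norm ?fine_ge0// -lee_fin fineK.
Unshelve. all: by end_near. Qed.

End asymptotics.

Lemma leq_bin_exp (n m : nat) : ('C(n, m) <= n ^ m)%N.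
Proof.
suff h k : (n ^_ k <= n ^ k)%N.
  by apply: leq_trans (h m); rewrite -bin_ffact leq_pmulr// fact_gt0.
by elim: k => [|k IH]; rewrite ?ffactn0// ffactnSr expnSr leq_mul// leq_subr.
Qed.

Lemma sample_size_bounds (R : realType) (theta : R) (p n : nat) : `|n%:R - p%:R `^ theta| < 1 ->
  2 <= p%:R `^ theta ->
  [/\ (0 < n)%N, p%:R `^ theta / 2 <= n%:R & n%:R <= 2 * p%:R `^ theta].
Proof.
rewrite ltr_norml => /andP[n1 n2] h; split; [rewrite -(ltr0n R)| |]; lra.
Qed.

Lemma mulr_eps (R : realType) (beta : R) (p : nat) : (0 < p)%N ->
  p%:R * eps beta p = p%:R `^ (1 - beta).
Proof.
move=> p0; rewrite /eps -{1}[p%:R](powRr1 (ler0n _ p)) -powRD//.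
by rewrite (gt_eqF (_ : 0 < p%:R)) ?implybT// ltr0n.
Qed.

(** Each of the four terms gets a quarter of [ep]. The range of [p] is uniform in [n], which is
    known only up to rounding. *)
Lemma simple_rate (R : realType) (alpha beta theta : R)
    (halpha : 0 < alpha < 1) (hbeta : 0 < beta < 1) (htheta : 0 < theta < 1) (ep : R) :
  0 < ep -> alpha + beta < 2^-1 -> alpha < theta / 2 ->
  \forall p \near \oo, forall n : nat, `|n%:R - p%:R `^ theta| < 1 ->
  [/\ (0 < p)%N, (0 < n)%N,
    Num.sqrt (2 * ln p%:R) <= Num.sqrt n%:R * tau alpha p &
    p%:R * (n%:R * (2 * expR (- ((tau alpha p * (p%:R * eps beta p / 2)) ^+ 2 / p%:R / 2)))
            + expR (- (p%:R * eps beta p / 16)))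
    + p%:R * (2 * expR (- (Num.sqrt (2 * ln p%:R) ^+ 2 / 2)) +
              eps beta p * (2 * expR (- ((Num.sqrt n%:R * tau alpha p -
                Num.sqrt (2 * ln p%:R)) ^+ 2 / 2))))
    <= ep * (p%:R * eps beta p)].
Proof.
move=> ep0 ab at2.
have ep16 : 0 < ep / 16 by rewrite divr_gt0.
have ep4 : 0 < ep / 4 by rewrite divr_gt0.
have ep8 : 0 < ep / 8 by rewrite divr_gt0.
have c0 : 0 < 1 - 2 * alpha - 2 * beta by lra.
have [/andP[al0 al1] /andP[be0 be1] /andP[th0 th1]] := And3 halpha hbeta htheta.
have b0 : 0 < 1 - beta by lra.
have q0 : 0 < theta - 2 * alpha by lra.
have eighth : 0 < 8^-1 :> R by rewrite invr_gt0.
have sixteenth : 0 < 16^-1 :> R by rewrite invr_gt0.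
near=> p => n nth.
have p0n : (0 < p)%N by near: p; exact: nbhs_infty_gt.
have p0 : 0 < p%:R :> R by rewrite ltr0n.
have th2 : 2 <= p%:R `^ theta by near: p; exact: powR_nat_ge.
have [n0 n1 n2] := sample_size_bounds nth th2.
have h1 : p%:R `^ (beta + theta) * expR (- (8^-1 * p%:R `^ (1 - 2 * alpha - 2 * beta))) <= ep / 16.
  by near: p; exact: powR_expR_le.
have h2 : p%:R `^ beta * expR (- (16^-1 * p%:R `^ (1 - beta))) <= ep / 4.
  by near: p; exact: powR_expR_le.
have h3 : 8 / ep <= p%:R `^ (1 - beta) by near: p; exact: powR_nat_ge.
have h4 : p%:R `^ (- 1) <= ep / 8 by near: p; exact: powR_natN_le.
have h5 : 16 * ln p%:R <= p%:R `^ (theta - 2 * alpha) by near: p; exact: ln_nat_le_powR.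
have lnp : 0 <= ln p%:R :> R by rewrite ln_ge0// ler1n.
pose x := p%:R : R.
have PD (a b : R) : x `^ (a + b) = x `^ a * x `^ b.
  by rewrite powRD// (gt_eqF p0) implybT.
have Pp : x = x `^ (1 - beta) * x `^ beta by rewrite -PD subrK powRr1// ltW.
have P0 a : 0 < x `^ a by rewrite powR_gt0.
set r := Num.sqrt (2 * ln p%:R).
have r0 : 0 <= r by exact: sqrtr_ge0.
have r2 : r ^+ 2 = 2 * ln p%:R by rewrite sqr_sqrtr// mulr_ge0.
have ta0 : 0 < tau alpha p by exact: P0.
(* A signal of twice the threshold leaves a margin of at least [r], so a signal is missed with
   probability at most [2 / p], the bound used for false positives. The 16 in [h5] is 8 from
   [(2 r) ^ 2] times 2 from [n >= p ^ theta / 2]. *)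
have snta : 2 * r <= Num.sqrt n%:R * tau alpha p.
  rewrite -ler_sqr ?nnegrE ?mulr_ge0 ?sqrtr_ge0 ?(ltW ta0)//.
  rewrite !exprMn r2 sqr_sqrtr//.
  have taE : x `^ theta * tau alpha p ^+ 2 = x `^ (theta - 2 * alpha).
    rewrite (_ : theta - 2 * alpha = theta + (- alpha + - alpha)); last by ring.
    by rewrite !PD expr2.
  have : x `^ theta / 2 * tau alpha p ^+ 2 <= n%:R * tau alpha p ^+ 2.
    by rewrite ler_wpM2r// sqr_ge0.
  by move: h5; rewrite -taE; clear; lra.
have rsn : r <= Num.sqrt n%:R * tau alpha p by move: r0 snta; clear; lra.
split => //.
have pinv : expR (- ln x) = x `^ (- 1) by rewrite expRN_ln// powR_inv1// ltW.
have peE : p%:R * eps beta p = x `^ (1 - beta) by exact: mulr_eps.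
have T1 : p%:R * (n%:R * (2 * expR (- ((tau alpha p * (p%:R * eps beta p / 2)) ^+ 2 / p%:R / 2))))
    <= ep / 4 * x `^ (1 - beta).
  have -> : (tau alpha p * (p%:R * eps beta p / 2)) ^+ 2 / p%:R / 2 =
      8^-1 * x `^ (1 - 2 * alpha - 2 * beta).
    rewrite (_ : 1 - 2 * alpha - 2 * beta =
      1 + (- alpha + (- alpha + (- beta + - beta)))); last by ring.
    by rewrite !PD powRr1 ?(ltW p0)// /tau /eps -/x; field; rewrite gt_eqF.
  move: h1; rewrite -/x PD; set E := expR _ => h1.
  have E0 : 0 <= E by exact: expR_ge0.
  have -> : p%:R * (n%:R * (2 * E)) = x `^ (1 - beta) * (2 * (x `^ beta * (n%:R * E))).
    by rewrite -/x {1}Pp; ring.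
  rewrite [leRHS]mulrC ler_pM2l//.
  have : x `^ beta * (n%:R * E) <= x `^ beta * (2 * x `^ theta * E).
    by rewrite ler_pM2l// ler_wpM2r.
  by move: h1; clear; lra.
have T2 : p%:R * expR (- (p%:R * eps beta p / 16)) <= ep / 4 * x `^ (1 - beta).
  rewrite peE -/x {1}Pp -mulrA [leRHS]mulrC ler_pM2l//.
  by rewrite (mulrC _ 16^-1).
have T3 : p%:R * (2 * expR (- (r ^+ 2 / 2))) <= ep / 4 * x `^ (1 - beta).
  rewrite r2 (_ : 2 * ln p%:R / 2 = ln x); last by rewrite /x; field.
  rewrite expRN_ln// mulrCA divff ?mulr1 ?gt_eqF//.
  have : ep / 4 * (8 / ep) <= ep / 4 * x `^ (1 - beta) by rewrite ler_pM2l.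
  by rewrite (_ : ep / 4 * (8 / ep) = 2)//; field; rewrite gt_eqF.
have T4 : p%:R * (eps beta p * (2 * expR (- ((Num.sqrt n%:R * tau alpha p - r) ^+ 2 / 2))))
    <= ep / 4 * x `^ (1 - beta).
  rewrite mulrA peE [leRHS]mulrC ler_pM2l//.
  have : expR (- ((Num.sqrt n%:R * tau alpha p - r) ^+ 2 / 2)) <= expR (- ln x).
    rewrite ler_expR lerN2.
    have : r ^+ 2 <= (Num.sqrt n%:R * tau alpha p - r) ^+ 2.
      by rewrite ler_sqr ?nnegrE//; move: r0 snta; clear; lra.
    by rewrite r2 -/x; clear; lra.
  by rewrite pinv; move: h4; rewrite -/x; clear; lra.
by rewrite peE !mulrDr; move: T1 T2 T3 T4; rewrite peE; clear; lra.
Unshelve. all: by end_near. Qed.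

Lemma sparse_size_bounds (R : realType) (beta : R) (hbeta : 0 < beta < 1) (p : nat) : (0 < p)%N ->
  [/\ (0 < sparse_size beta p)%N, (sparse_size beta p <= p)%N,
      p%:R * eps beta p <= (sparse_size beta p)%:R &
      (sparse_size beta p)%:R <= p%:R * eps beta p + 1].
Proof.
move=> p0n; have p0 : 0 < p%:R :> R by rewrite ltr0n.
have pe0 : 0 < p%:R * eps beta p by rewrite mulr_gt0// powR_gt0.
have /andP[be0 be1] := hbeta.
have c0 : 0 <= Num.ceil (p%:R * eps beta p) by rewrite ltW// ceil_gt0.
have NE : (sparse_size beta p)%:R = (Num.ceil (p%:R * eps beta p))%:~R :> R.
  by rewrite /sparse_size natr_absz ger0_norm.
split.
- by rewrite /sparse_size absz_gt0 gt_eqF// ceil_gt0.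
- rewrite -(ler_nat R) NE -[p%:R]/((p%:Z)%:~R) ler_int ceil_le_int.
  rewrite [leRHS](_ : _ = p%:R)//.
  rewrite mulr_eps// -[leRHS](powRr1 (ltW p0)); apply: ler_powR; first by rewrite ler1n.
  by rewrite lerBlDr lerDl ltW.
- by rewrite NE ceil_ge.
- rewrite NE; have := ceilB1_lt (p%:R * eps beta p).
  by rewrite intrB; lra.
Qed.

(* Here [x = p eps], [y = tau], [z = p ^ theta] and [L = log p]; [v] is the
   signal level of the true support and [t] the uniform deviation. *)
Lemma separation (R : realType) (k L x y z N n : R) : 0 < k -> 0 < L -> 0 < x -> 0 < y -> 0 < z ->
  0 < N -> N <= 2 * x -> z / 2 <= n ->
  64 / k ^+ 2 * L <= z * y ^+ 2 -> 512 / k ^+ 2 * L <= z * y ^+ 4 * x ->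
  let t := Num.sqrt (8 * N * L / n) in
  let v := (Num.sqrt N)^-1 * (y * x) in
  t <= k * v /\ 2 * t <= k * v ^+ 2.
Proof.
move=> k0 L0 x0 y0 z0 N0 Nx zn h1 h2 t v.
have n0 : 0 < n by lra.
have t0 : 0 <= t by exact: sqrtr_ge0.
have sN : 0 < Num.sqrt N by rewrite sqrtr_gt0.
have v0 : 0 < v by rewrite mulr_gt0 ?invr_gt0 ?mulr_gt0.
have k20 : 0 < k ^+ 2 by rewrite exprn_gt0.
have t2 : t ^+ 2 = 8 * N * L / n.
  by rewrite sqr_sqrtr// ltW// divr_gt0// !mulr_gt0.
have v2 : v ^+ 2 * N = (y * x) ^+ 2.
  by rewrite exprMn exprVn sqr_sqrtr ?ltW// mulrAC mulVf ?mul1r// gt_eqF.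
(* Both claims are compared after squaring. This bound and the next one remove [N] and [n]; the
   constants 64 and 512 are what they leave in the two squared inequalities. *)
have v2lb : y ^+ 2 * x / 2 <= v ^+ 2.
  rewrite -(ler_pM2r N0) v2 (_ : _ * N = y ^+ 2 * x * (N / 2)); last by ring.
  rewrite (_ : (y * x) ^+ 2 = y ^+ 2 * x * x); last by ring.
  by rewrite ler_pM2l ?mulr_gt0 ?exprn_gt0//; lra.
have t2ub : t ^+ 2 <= 32 * x * L / z.
  rewrite t2 ler_pdivrMr// [leRHS]mulrAC ler_pdivlMr//.
  have : 8 * N * L * z <= 8 * (2 * x) * L * z.
    by rewrite ler_pM2r// ler_pM2r// ler_pM2l.
  have : 32 * x * L * (z / 2) <= 32 * x * L * n by rewrite ler_pM2l// !mulr_gt0.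
  lra.
have h1' : 32 * x * L / z <= k ^+ 2 * (y ^+ 2 * x / 2).
  rewrite ler_pdivrMr//.
  have : k ^+ 2 * x / 2 * (64 / k ^+ 2 * L) <= k ^+ 2 * x / 2 * (z * y ^+ 2).
    by rewrite ler_pM2l// divr_gt0// mulr_gt0.
  rewrite (_ : k ^+ 2 * x / 2 * (64 / k ^+ 2 * L) = 32 * x * L); last by field; rewrite gt_eqF.
  lra.
have h2' : 4 * (32 * x * L / z) <= k ^+ 2 * (y ^+ 2 * x / 2) ^+ 2.
  rewrite mulrA ler_pdivrMr//.
  have : k ^+ 2 * x / 4 * (512 / k ^+ 2 * L) <= k ^+ 2 * x / 4 * (z * y ^+ 4 * x).
    by rewrite ler_pM2l// divr_gt0// mulr_gt0.
  rewrite (_ : k ^+ 2 * x / 4 * (512 / k ^+ 2 * L) = 128 * x * L); last by field; rewrite gt_eqF.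
  rewrite (_ : k ^+ 2 * (y ^+ 2 * x / 2) ^+ 2 * z = k ^+ 2 * x / 4 * (z * y ^+ 4 * x));
    last by field.
  lra.
split.
  rewrite -ler_sqr ?nnegrE ?(ltW (mulr_gt0 k0 v0))//.
  apply: le_trans t2ub _; apply: le_trans h1' _.
  by rewrite exprMn ler_pM2l.
have kv0 : 0 <= k * v ^+ 2 by rewrite mulr_ge0 ?sqr_ge0// ltW.
have tt0 : 0 <= 2 * t by rewrite mulr_ge0.
rewrite -ler_sqr ?nnegrE//.
rewrite [leLHS]exprMn [leRHS]exprMn t2; apply: (@le_trans _ _ (4 * (32 * x * L / z))).
  by rewrite -t2 (_ : 2 ^+ 2 = 4 :> R) ?ler_pM2l//; ring.
apply: le_trans h2' _; rewrite ler_pM2l// ler_sqr ?nnegrE ?sqr_ge0//.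
by rewrite ltW// divr_gt0// mulr_gt0// exprn_gt0.
Qed.

(* [t] is chosen so that [n t ^ 2 / 4 = 2 N log p], which beats the [p ^ N] sets
   of the union bound. *)
Lemma sparse_rate (R : realType) (alpha beta theta : R)
    (halpha : 0 < alpha < 1) (hbeta : 0 < beta < 1) (htheta : 0 < theta < 1)
    (k dl ep : R) : 0 < k -> 0 < dl -> dl <= 4^-1 -> 0 < ep ->
  alpha < theta / 2 -> 4 * alpha < 1 + theta - beta ->
  \forall p \near \oo, forall n : nat, `|n%:R - p%:R `^ theta| < 1 ->
  let N := sparse_size beta p in
  let t := Num.sqrt (8 * N%:R * ln p%:R / n%:R) in
  let v := (Num.sqrt N%:R)^-1 * (tau alpha p * (p%:R * eps beta p)) in
  [/\ (0 < p)%N, (0 < n)%N, 0 < t,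
    2 * t <= 2 * k * Num.min ((1 - 2 * dl) * v) 1 * (dl * v) &
    N%:R + p%:R * eps beta p - 2 * ((1 - 2 * dl) * (p%:R * eps beta p)) +
    2 * (p%:R * eps beta p) * (expR (- (p%:R * eps beta p * dl ^+ 2 / 4)) +
      'C(p, N)%:R * (2 * expR (- (n%:R * t ^+ 2 / 4))))
    <= (ep + 4 * dl) * (p%:R * eps beta p)].
Proof.
move=> k0 dl0 dl4 ep0 at2 at4.
have [/andP[al0 al1] /andP[be0 be1] /andP[th0 th1]] := And3 halpha hbeta htheta.
have b0 : 0 < 1 - beta by lra.
have q0 : 0 < theta - 2 * alpha by lra.
have q1 : 0 < 1 + theta - beta - 4 * alpha by lra.
have kd0 : 0 < k * dl by rewrite mulr_gt0.
have ep8 : 0 < ep / 8 by rewrite divr_gt0.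
have ep6 : 0 < ep / 6 by rewrite divr_gt0.
have dl24 : 0 < dl ^+ 2 / 4 by rewrite divr_gt0// exprn_gt0.
near=> p => n nth.
set N := sparse_size beta p; set t := Num.sqrt (8 * N%:R * ln p%:R / n%:R).
set v := (Num.sqrt N%:R)^-1 * _.
have p2 : (1 < p)%N by near: p; exact: nbhs_infty_gt.
have p0n : (0 < p)%N by exact: ltnW.
have p0 : 0 < p%:R :> R by rewrite ltr0n.
have th2 : 2 <= p%:R `^ theta by near: p; exact: powR_nat_ge.
have [n0 n1 n2] := sample_size_bounds nth th2.
have [N0 Np Npe peN] := sparse_size_bounds hbeta p0n.
rewrite -/N in N0 Np Npe peN.
have h1 : 64 / (k * dl) ^+ 2 * ln p%:R <= p%:R `^ (theta - 2 * alpha).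
  by near: p; exact: ln_nat_le_powR.
have h2 : 512 / (k * dl) ^+ 2 * ln p%:R <= p%:R `^ (1 + theta - beta - 4 * alpha).
  by near: p; exact: ln_nat_le_powR.
have h3 : Num.max 1 (3 / ep) <= p%:R `^ (1 - beta) by near: p; exact: powR_nat_ge.
have h4 : p%:R `^ (- 1) <= ep / 12 by near: p; apply: powR_natN_le => //; rewrite divr_gt0.
have h5 : p%:R `^ 0 * expR (- (dl ^+ 2 / 4 * p%:R `^ (1 - beta))) <= ep / 6.
  by near: p; exact: powR_expR_le.
have lnp : 0 < ln p%:R :> R by rewrite ln_gt0// ltr1n.
pose x := p%:R : R.
have PD (a b : R) : x `^ (a + b) = x `^ a * x `^ b.
  by rewrite powRD// (gt_eqF p0) implybT.
have P0 a : 0 < x `^ a by rewrite powR_gt0.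
have peE : p%:R * eps beta p = x `^ (1 - beta) by exact: mulr_eps.
have ta0 : 0 < tau alpha p by exact: P0.
have N0R : 0 < N%:R :> R by rewrite ltr0n.
have n0R : 0 < n%:R :> R by rewrite ltr0n.
have pe1 : 1 <= x `^ (1 - beta) by apply: le_trans h3; rewrite le_max lexx.
have pe3 : 3 / ep <= x `^ (1 - beta) by apply: le_trans h3; rewrite le_max lexx orbT.
have t0 : 0 < t by rewrite sqrtr_gt0 divr_gt0// !mulr_gt0.
have v0 : 0 < v.
  by rewrite mulr_gt0 ?invr_gt0 ?sqrtr_gt0// mulr_gt0// peE.
have [s1 s2] : t <= k * dl * v /\ 2 * t <= k * dl * v ^+ 2.
  rewrite /t /v peE; apply: (@separation _ _ _ _ _ (x `^ theta)) => //.
  - by move: peN pe1; rewrite peE; clear; lra.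
  - rewrite (_ : x `^ theta * _ = x `^ (theta - 2 * alpha))//.
    rewrite (_ : theta - 2 * alpha = theta + (- alpha + - alpha)); last by ring.
    by rewrite !PD expr2.
  - rewrite (_ : x `^ theta * _ * _ = x `^ (1 + theta - beta - 4 * alpha))//.
    rewrite (_ : 1 + theta - beta - 4 * alpha =
      theta + ((- alpha + (- alpha + (- alpha + - alpha))) + (1 - beta))); last by ring.
    by rewrite !PD /tau -/x; ring.
split => //.
  rewrite (_ : 2 * k * _ * (dl * v) =
    2 * (k * dl * v * Num.min ((1 - 2 * dl) * v) 1)); last by ring.
  rewrite ler_pM2l//.
  have kv0 : 0 < k * dl * v by rewrite mulr_gt0.
  rewrite minEle; case: ifP => _; last by rewrite mulr1.
  have : k * dl * v * (v / 2) <= k * dl * v * ((1 - 2 * dl) * v).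
    by rewrite ler_pM2l// mulrC ler_pM2r//; move: dl4; clear; lra.
  apply: le_trans.
  have -> : k * dl * v * (v / 2) = k * dl * v ^+ 2 / 2 by ring.
  by move: s2; clear; lra.
have pinv : expR (- ln x) = x `^ (- 1) by rewrite expRN_ln// powR_inv1// ltW.
have T1 : 'C(p, N)%:R * (2 * expR (- (n%:R * t ^+ 2 / 4))) <= ep / 6.
  have -> : n%:R * t ^+ 2 / 4 = N%:R * (2 * ln x).
    rewrite sqr_sqrtr; first by rewrite /x; field; rewrite gt_eqF.
    by rewrite ltW// divr_gt0// !mulr_gt0.
  have CpN : 'C(p, N)%:R <= expR (N%:R * ln x).
    rewrite expRM_natl lnK ?posrE// -natrX ler_nat; exact: leq_bin_exp.
  apply: (@le_trans _ _ (expR (N%:R * ln x) * (2 * expR (- (N%:R * (2 * ln x)))))).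
    by rewrite ler_wpM2r// mulr_ge0// expR_ge0.
  rewrite mulrCA -expRD.
  (* What remains after the union bound is [p ^ (- N)], at most [1 / p] because [N >= 1]. *)
  have : expR (N%:R * ln x + - (N%:R * (2 * ln x))) <= expR (- ln x).
    rewrite ler_expR (_ : _ + _ = - (N%:R * ln x)); last by ring.
    by rewrite lerN2 ler_peMl ?(ltW lnp)// ler1n.
  by rewrite pinv; move: h4; rewrite -/x; clear; lra.
have T2 : expR (- (p%:R * eps beta p * dl ^+ 2 / 4)) <= ep / 6.
  move: h5; rewrite powRr0 mul1r; apply: le_trans.
  by rewrite peE ler_expR lerN2 le_eqVlt; apply/orP; left; apply/eqP; rewrite /x; ring.
(* Absorbs the excess of at most 1 in [N] caused by the ceiling. *)
have T3 : 1 <= ep / 3 * (p%:R * eps beta p).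
  rewrite peE; have : ep / 3 * (3 / ep) <= ep / 3 * x `^ (1 - beta).
    by rewrite ler_pM2l// divr_gt0.
  by rewrite (_ : ep / 3 * (3 / ep) = 1)//; field; rewrite gt_eqF.
move: peN T1 T2 T3 (P0 (1 - beta)); rewrite peE; clear.
set y := x `^ _; set E2 := 'C(p, N)%:R * _; set E1 := expR _.
move=> peN T1 T2 T3 y0.
have : 2 * y * (E1 + E2) <= 2 * y * (ep / 6 + ep / 6).
  by apply: ler_wpM2l; [rewrite mulr_ge0// ltW | exact: lerD].
by lra.
Unshelve. all: by end_near. Qed.

Lemma hamm_le (R : realType) (beta : R) (p : nat) (d : measure_display)
    (T : measurableType d) (P : probability T R) (mu : 'I_p -> T -> R)
    (Shat : T -> {set 'I_p}) (c b : R) : (0 < p)%N ->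
  (\int[P]_w #|symdiff (Shat w) (signal_support mu w)|%:R%:E <= b%:E)%E ->
  b <= c * (p%:R * eps beta p) ->
  (0 <= hamm beta P mu Shat <= c%:E)%E.
Proof.
move=> p0 hb bc; rewrite /hamm unlock.
have pe0 : 0 < p%:R * eps beta p by rewrite mulr_gt0 ?powR_gt0 ?ltr0n.
have pei : (0 <= ((p%:R * eps beta p)^-1)%:E)%E by rewrite lee_fin invr_ge0 ltW.
rewrite mule_ge0//=; last by apply: integral_ge0 => w _; rewrite lee_fin.
apply: (@le_trans _ _ (((p%:R * eps beta p)^-1)%:E * b%:E)%E).
  by rewrite lee_wpmul2l.
by rewrite -EFinM lee_fin ler_pdivrMl// mulrC.
Qed.

Theorem theorem3p2 (R : realType) (alpha beta theta : R)
  (halpha : 0 < alpha < 1) (hbeta : 0 < beta < 1) (htheta : 0 < theta < 1)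
  (heta : alpha < eta_sig theta beta)
  (n : nat -> nat) (d : nat -> measure_display)
  (Omega : forall p, measurableType (d p))
  (P : forall p, probability (Omega p) R)
  (l : forall p, 'I_(n p) -> {RV (P p) >-> R})
  (mu : forall p, 'I_p -> {RV (P p) >-> R})
  (Z : forall p, 'I_(n p) -> 'I_p -> {RV (P p) >-> R})
  (harw : forall p, arw_model alpha beta theta (l p) (mu p) (Z p)) :
  let X := fun p => arw_data (l p) (mu p) (Z p) in
  (0 < beta < (1 - theta) / 2 ->
     hamm beta (P p) (mu p) (fun w => sa_support (X p w)) @[p --> \oo]
       --> 0%E) /\
  ((1 - theta) / 2 < beta < 1 ->
     forall Shat : forall p, 'M[R]_(n p, p) -> {set 'I_p},
       (forall p M, is_sparse_sa_support (sparse_size beta p) M (Shat p M)) ->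
       (forall p (S : {set 'I_p}), measurable [set w | Shat p (X p w) = S]) ->
       hamm beta (P p) (mu p) (fun w => Shat p (X p w)) @[p --> \oo]
         --> 0%E).
Proof.
move=> X.
(* [eta_sig] is the minimum of [theta / 2] and [(1 + theta - beta) / 4], the two expressions
   crossing at [beta = 1 - theta]; hence both bounds hold throughout. *)
have at2 : alpha < theta / 2.
  by move: heta; rewrite /eta_sig; case: (leP beta (1 - theta)) => h a1; lra.
have at4 : 4 * alpha < 1 + theta - beta.
  by move: heta; rewrite /eta_sig; case: (leP beta (1 - theta)) => h a1; lra.
split=> [/andP[b0 b1]|_ Shat Smax Smeas]; apply: cvg0_ereal_le => ep ep0.
  (* Adding [alpha < theta / 2] and [beta < (1 - theta) / 2]. *)
  have ab : alpha + beta < 2^-1 by lra.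
  move: (simple_rate halpha hbeta htheta ep0 ab at2); apply: filterS => p rate.
  have [p0 n0 rsn bnd] := rate (n p) (arw_size (harw p)).
  apply: (hamm_le p0 _ bnd).
  by apply: (sa_hamming_bound (harw p)) => //; rewrite ?ltW// powR_gt0// ltr0n.
pose k : R := normal_pdf 0 1 1.
have k0 : 0 < k.
  by rewrite /k normal_pdfE1// mulr_gt0 ?expR_gt0// normal_peak_gt0.
(* [ep / 8] makes the loss [4 dl] at most [ep / 2], and [1 / 8] meets the upper bounds required of
   [dl]. *)
pose dl := Num.min (ep / 8) 8^-1.
have dl0 : 0 < dl by rewrite lt_min divr_gt0//= invr_gt0.
have dl8 : dl <= 8^-1 by rewrite ge_min lexx orbT.
have dlep : dl <= ep / 8 by rewrite ge_min lexx.
have dl4 : dl <= 4^-1 by lra.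
have ep2 : 0 < ep / 2 by rewrite divr_gt0.
move: (sparse_rate halpha hbeta htheta k0 dl0 dl4 ep2 at2 at4); apply: filterS => p rate.
have [p0 n0 t0 sep bnd] := rate (n p) (arw_size (harw p)).
have [N0 Np Npe _] := sparse_size_bounds hbeta p0.
have e0 : 0 < eps beta p by rewrite powR_gt0// ltr0n.
have ta0 : 0 < tau alpha p by rewrite powR_gt0// ltr0n.
have bnd' : (ep / 2 + 4 * dl) * (p%:R * eps beta p) <= ep * (p%:R * eps beta p).
  by rewrite ler_pM2r ?mulr_gt0 ?ltr0n//; lra.
apply: (hamm_le p0 _ (le_trans bnd bnd')).
apply: (sparse_sa_hamming_bound (harw p) n0 N0 Np (Shat := fun w => Shat p (X p w))
  _ _ t0 _ ta0 (ltW e0) Npe sep) => //.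
by rewrite dl0; lra.
Qed.
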